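(* Let $a,b\in\mathbb{R}$ with $b\neq 0$. Let $f:\mathbb{R}\to\mathbb{R}$ be nontrivial (not vanishing identically) with $f\in L^2(\mathbb{R})$, and let $\mathcal{K}:\mathbb{R}\to\mathbb{R}$ be not identically zero with $\mathcal{K}\in L^1(\mathbb{R})$. Let $M>0$ and let $g:\mathbb{R}\to\mathbb{R}$ be a function, not identically zero, with $g(0)=0$, $g'\in L^\infty(\mathbb{R})$ and $\|g'\|_{L^\infty(\mathbb{R})}\le M$. Let $0<\rho\le 1$, let $u_0\in L^2(\mathbb{R})$ be the unique solution in $L^2(\mathbb{R})$ of the linear equation $$\Big[\tfrac12\ln\Big(-\frac{d^2}{dx^2}\Big)\Big]u_0-b\frac{du_0}{dx}-au_0=f(x),\qquad x\in\mathbb{R},$$ and let $B_\rho:=\{u\in L^2(\mathbb{R}) : \|u\|_{L^2(\mathbb{R})}\le\rho\}$. Suppose $$0<\varepsilon\le\frac{\rho\, C_{a,b}}{M\|\mathcal{K}\|_{L^1(\mathbb{R})}\,(\|u_0\|_{L^2(\mathbb{R})}+1)}.$$ Then the equation $$\Big[\tfrac12\ln\Big(-\frac{d^2}{dx^2}\Big)\Big]u-b\frac{du}{dx}-au=\varepsilon\int_{-\infty}^{\infty}\mathcal{K}(x-y)\,g(u_0(y)+v(y))\,dy \qquad (v\in B_\rho \text{ given},\ u \text{ unknown})$$ defines a map $t_g:B_\rho\to B_\rho$, $t_g v:=u$, where $u$ is the unique solution of this equation in $B_\rho$, and $t_g$ is a strict contraction with respect to the $L^2(\mathbb{R})$ norm.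 The unique fixed point $u_p$ of $t_g$ is the only solution in $B_\rho$ of the equation $$\Big[\tfrac12\ln\Big(-\frac{d^2}{dx^2}\Big)\Big]u_p-b\frac{du_p}{dx}-au_p=\varepsilon\int_{-\infty}^{\infty}\mathcal{K}(x-y)\,g(u_0(y)+u_p(y))\,dy.$$
   Context: Functions in $L^2(\mathbb{R})$ are real-valued here. The Fourier transform is $\widehat{\phi}(p)=\frac{1}{\sqrt{2\pi}}\int_{-\infty}^\infty\phi(x)e^{-ipx}dx$ (extended to $L^2(\mathbb{R})$ as usual). The logarithmic Laplacian $\ln(-\frac{d^2}{dx^2})$ is the operator with Fourier symbol $2\ln|p|$. Hence the operator $L_{a,b}:=\frac12\ln(-\frac{d^2}{dx^2})-b\frac{d}{dx}-a$, considered on $L^2(\mathbb{R})$, has Fourier symbol $$\lambda_{a,b}(p)=\ln\Big(\frac{|p|}{e^a}\Big)-ibp.$$ A function $u\in L^2(\mathbb{R})$ is a solution of $L_{a,b}u=h$, with $h\in L^2(\mathbb{R})$, if $\lambda_{a,b}(p)\widehat{u}(p)=\widehat{h}(p)$ for a.e. $p\in\mathbb{R}$. Since $b\ne0$, $|\lambda_{a,b}(p)|=\sqrt{\ln^2(|p|/e^a)+b^2p^2}$ is bounded below by a positive constant; $C_{a,b}>0$ denotes a fixed constant, depending only on $a,b$, with $|\lambda_{a,b}(p)|\ge C_{a,b}$ for all $p\in\mathbb{R}\setminus\{0\}$. For every $f\in L^2(\mathbb{R})$ the equation $L_{a,b}u_0=f$ has a unique solution $u_0\in L^2(\mathbb{R})$.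 The condition $g'\in L^\infty(\mathbb{R})$ is understood so that $g$ is recovered from its derivative: $g$ is locally absolutely continuous and $g(s)-g(t)=\int_t^s g'(z)\,dz$ for all $s,t\in\mathbb{R}$. *)

(* Defs.v *)
From HB Require Import structures.
From mathcomp Require Import all_boot all_order all_algebra.
From mathcomp Require Import complex.
From mathcomp Require Import all_classical all_reals all_analysis.

Set Implicit Arguments.
Unset Strict Implicit.
Unset Printing Implicit Defensive.
Import Order.TTheory GRing.Theory Num.Theory.
Import numFieldNormedType.Exports.

Local Open Scope classical_set_scope.
Local Open Scope ring_scope.
Local Open Scope complex_scope.

Notation leb R := (@lebesgue_measure R).

Section Lp_spaces.
Context {R : realType}.
Implicit Types f g : R -> R.

Definition normL1 f : R := fine 'N[leb R]_1[EFin \o f].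

Definition normL2 f : R := fine 'N[leb R]_2%:R%:E[EFin \o f].

(* L^2(R) as a space of classes modulo a.e. equality; an element coerces to a
   (Borel measurable, square integrable) representative. *)
Definition L2 := LspaceType2 (leb R).

Definition distL2 (u v : L2) : R := normL2 (fun x => u x - v x).

Definition ballL2 (rho : R) : set L2 := [set u | normL2 u <= rho].

End Lp_spaces.
Arguments L2 : clear implicits.

Section fourier.
Context {R : realType}.
Implicit Types (phi : R -> R) (F : R -> R[i]).

Definition expi (t : R) : R[i] := cos t +i* sin t.

Definition cintegral (A : set R) F : R[i] :=
  (\int[leb R]_(x in A) complex.Re (F x)) +i*
  (\int[leb R]_(x in A) complex.Im (F x)).

(* (2 pi)^(-1/2) times the integral of phi(x) e^(-ipx) over A *)
Definition fourier_on (A : set R) phi (p : R) : R[i] :=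
  ((Num.sqrt (2 * pi))^-1)%:C *
  cintegral A (fun x => (phi x)%:C * expi (- (p * x))).

(* F is (a representative of) the Fourier-Plancherel transform of phi in
   L^2(R): the limit in L^2(R; C) of the transforms of the truncations of phi
   to [-n, n], which are integrable. *)
Definition is_fourier phi F : Prop :=
  [/\ phi \in Lfun (leb R) 2%:R%:E,
      (fun p => complex.Re (F p)) \in Lfun (leb R) 2%:R%:E,
      (fun p => complex.Im (F p)) \in Lfun (leb R) 2%:R%:E &
      ('N[leb R]_2%:R%:E[EFin \o (fun p : R =>
         Normc.normc (F p - fourier_on `[- n%:R, n%:R] phi p)%R)]
       @[n --> \oo] --> 0)%E].

End fourier.

Section equation.
Context {R : realType}.
Implicit Types (a b : R) (u h K g : R -> R).

(* The symbol ln(|p| / e^a) - i b p; at the single point p = 0 the logarithm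
   takes the junk value ln 0 = 0. *)
Definition symbol a b (p : R) : R[i] := ln (`|p| / expR a) -i* (b * p).

(* u in L^2(R) solves (1/2) ln(-d^2/dx^2) u - b u' - a u = h, h in L^2(R) *)
Definition is_solution a b h u : Prop :=
  exists U H : R -> R[i],
    [/\ is_fourier u U, is_fourier h H &
        {ae leb R, forall p, symbol a b p * U p = H p}].

Definition nonlinear_rhs (eps : R) K g u0 (v : R -> R) : R -> R :=
  fun x => eps * \int[leb R]_y (K (x - y) * g (u0 y + v y)).

End equation.

Section derivative.
Context {R : realType}.
Implicit Types g : R -> R.

Definition locally_absolutely_continuous g : Prop :=
  forall c d e : R, 0 < e -> exists2 delta : R, 0 < delta &
    forall (n : nat) (s t : 'I_n -> R),
      (forall i, [/\ c <= s i, s i <= t i & t i <= d]) ->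
      trivIset [set: 'I_n] (fun i => `]s i, t i[%classic) ->
      \sum_(i < n) (t i - s i) < delta ->
      \sum_(i < n) `|g (t i) - g (s i)| < e.

(* derive1 g is the pointwise derivative, with a junk value on the null set where
   g is not derivable. *)
Definition recovered_from_derivative g : Prop :=
  [/\ locally_absolutely_continuous g,
      {ae leb R, forall z, derivable g z 1} &
      forall s t : R, t <= s ->
        g s - g t = \int[leb R]_(z in `[t, s]) derive1 g z].

End derivative.

(* Main.v *)
Require Import Defs.
From HB Require Import structures.
From mathcomp Require Import all_boot all_order all_algebra.
From mathcomp Require Import complex.
From mathcomp Require Import all_classical all_reals all_analysis.
From mathcomp Require Import measurable_realfun ess_sup_inf.
From mathcomp Require Import ring lra.

Set Implicit Arguments.
Unset Strict Implicit.
Unset Printing Implicit Defensive.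
Import Order.TTheory GRing.Theory Num.Theory.
Import numFieldNormedType.Exports.

Local Open Scope classical_set_scope.
Local Open Scope ring_scope.

(** The proof is the contraction argument in the ball, and all its analytic
   content is Plancherel's theorem: it provides a real-valued solution of the
   linear equation, its uniqueness, and the bound |u| <= |h| / C.

   As functions are real-valued, Plancherel's theorem is proved for the Hartley
   transform Hf(p) = (2 pi)^(-1/2) int f(x) (cos (px) + sin (px)) dx, whose kernel
   is real and symmetric.  The Fourier transform of f is the even part of Hf
   minus i times its odd part (fourier_of), so that the square of its modulus
   at p is the mean of Hf(p)^2 and Hf(-p)^2.  The theorem to be proved is then
   that H extends to an isometric involution of the real space L2
   (is_hartley_isometry, is_hartley_sym); in particular a Hermitian symmetric
   function in L2 is the transform of a real function.

   - H is a contraction (hartley_L1_contraction): if |Hf|^2 is damped by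
     exp (- e |p|), Fubini's theorem turns its integral into 1/(2 pi) times
     int int f(x) f(y) P(x - y), where P is a Poisson kernel of mass 2 pi.
     Young's inequality bounds this by |f|^2, and e tends to 0.  Completeness of
     L2 extends H from truncated functions to L2.
   - For the indicator of an interval the same double integral tends to the
     length of the interval, because most of the mass of P is near 0; so H
     preserves the norm of such an indicator x (normL2_box_le_hartley).  As H
     is self-adjoint and a contraction,
     |HHx - x|^2 = |HHx|^2 - 2 |Hx|^2 + |x|^2 <= 0, hence HHx = x.
   - For any f, self-adjointness makes HHf - f orthogonal to all indicators of
     intervals, so HHf = f.  A contraction which is an involution is an
     isometry.

   In terms of Fourier transforms the linear equation is a division by the
   symbol, whose modulus is at least C: this gives is_solution_ex and
   is_solution_bound.  The function g is Lipschitz with constant M, so by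
   Young's inequality the right-hand side has norm at most
   eps |K|_1 M (|u0| + |v|) and is Lipschitz in v with constant eps |K|_1 M.
   The bound on eps makes the solution map send the ball to itself, with
   contraction factor eps |K|_1 M / C <= rho / (|u0| + 1).  This is less than 1
   because u0 is not 0, since f is not 0.  Banach's fixed point argument in the
   ball concludes. *)

Local Notation inL2 f := (f \in Lfun (leb _) 2%:R%:E).

(** Lets type class search find the filter of sets of full Lebesgue measure,
   in spite of the several displays carried by the measurable structure of R. *)
#[local] Instance ae_filter (R : realType) :
  Filter (nbhs (almost_everywhere (leb R))).
Proof. exact: ae_filter_ringOfSetsType. Qed.

(** * The L2 norm of real functions *)

Section L2.
Context {R : realType}.
Notation mu := (leb R).
Implicit Types f g h : R -> R.

(** The square of the L2 norm, but always meaningful as an extended real: limits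
   and Tonelli's theorem are applied to it before integrability is known. *)
Definition energy f : \bar R := (\int[mu]_x (f x ^+ 2)%:E)%E.

Lemma energy_ge0 f : (0 <= energy f)%E.
Proof. by apply: integral_ge0 => x _; rewrite lee_fin sqr_ge0. Qed.

Lemma LnormE f : 'N[mu]_2%:R%:E[EFin \o f]%E = (energy f `^ 2^-1)%E.
Proof.
rewrite unlock; congr (_ `^ _)%E; apply: eq_integral => x _.
by rewrite /= powR_mulrn// real_normK// num_real.
Qed.

Lemma inL2P f : inL2 f <-> measurable_fun setT f /\ (energy f < +oo)%E.
Proof.
split=> [|[mf ef]].
  move=> /andP[/[!inE]/= mf]; rewrite /finite_norm LnormE => ef; split => //.
  exact: (@lty_poweRy _ _ 2^-1).
apply/andP; rewrite !inE/=; split => //.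
by rewrite /finite_norm LnormE poweR_lty.
Qed.

Lemma inL2_measurable f : inL2 f -> measurable_fun setT f.
Proof. by case/inL2P. Qed.

Lemma normL2_ge0 f : 0 <= normL2 f.
Proof. by rewrite fine_ge0// Lnorm_ge0. Qed.

Lemma LnormE_fin f : inL2 f -> 'N[mu]_2%:R%:E[EFin \o f]%E = (normL2 f)%:E.
Proof.
move=> /andP[_ /[!inE]/= ff]; rewrite /normL2 fineK// ge0_fin_numE ?Lnorm_ge0//.
Qed.

Lemma normL2_sqr f : inL2 f -> ((normL2 f) ^+ 2)%:E = energy f.
Proof.
move=> f2; rewrite -powR_mulrn ?normL2_ge0// -poweR_EFin -LnormE_fin// LnormE.
by rewrite -poweRrM mulVf// poweRe1// energy_ge0.
Qed.

(** The usual way to enter L2: a bound on the integral of the square. *)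
Lemma energy_le f (B : R) : 0 <= B -> measurable_fun setT f ->
  (energy f <= (B ^+ 2)%:E)%E -> inL2 f /\ normL2 f <= B.
Proof.
move=> B0 mf fB.
have f2 : inL2 f by apply/inL2P; split=> //; rewrite (le_lt_trans fB)// ltry.
split=> //; rewrite -(@ler_pXn2r _ 2)// ?nnegrE ?normL2_ge0//.
by rewrite -lee_fin normL2_sqr.
Qed.

Lemma inL2_dominated f g (B : R) : 0 <= B -> measurable_fun setT f -> inL2 g ->
  (forall x, `|f x| <= B * `|g x|) -> inL2 f /\ normL2 f <= B * normL2 g.
Proof.
move=> B0 mf g2 fg; apply: energy_le => //; first by rewrite mulr_ge0// normL2_ge0.
rewrite exprMn EFinM normL2_sqr// /energy -ge0_integralZl//; last 3 first.
- by apply/measurable_EFinP/measurable_funX; exact: inL2_measurable.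
- by move=> x _; rewrite lee_fin sqr_ge0.
- by rewrite lee_fin sqr_ge0.
apply: ge0_le_integral => //.
- by move=> x _; rewrite lee_fin sqr_ge0.
- by apply/measurable_EFinP/measurable_funX.
- apply/measurable_EFinP; apply: measurable_funM => //.
  by apply/measurable_funX; exact: inL2_measurable.
move=> x _; rewrite -EFinM lee_fin -exprMn -real_normK ?num_real//.
rewrite -[leRHS]real_normK ?num_real// ler_pXn2r ?nnegrE//.
by rewrite normrM (ger0_norm B0).
Qed.

Lemma inL2D f g : inL2 f -> inL2 g -> inL2 (fun x => f x + g x).
Proof. exact: (@Lfun_addr_closed _ _ R mu _ (lee1n 2)).2. Qed.

Lemma inL2N f : inL2 f -> inL2 (fun x => - f x).
Proof. exact: (@Lfun_oppr_closed _ _ R mu). Qed.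

Lemma inL2B f g : inL2 f -> inL2 g -> inL2 (fun x => f x - g x).
Proof. by move=> f2 g2; apply: inL2D => //; exact: inL2N. Qed.

Lemma inL2Z k f : inL2 f -> inL2 (fun x => k * f x).
Proof.
move=> f2; have [] := @inL2_dominated (fun x => k * f x) f `|k| => //.
  by apply: measurable_funM => //; exact: inL2_measurable.
by move=> x; rewrite normrM.
Qed.

Lemma inL2_norm f : inL2 f -> inL2 (fun x => `|f x|).
Proof.
move=> f2; apply: (inL2_dominated (B := 1) _ _ f2 _).1 => //.
  by apply: measurableT_comp => //; exact: inL2_measurable.
by move=> x; rewrite normr_id mul1r.
Qed.

Lemma inL2_0 : inL2 (fun _ : R => 0 : R).
Proof. exact: (@Lfun_addr_closed _ _ R mu _ (lee1n 2)).1. Qed.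

Lemma energy_eq f g : f = g %[ae mu] -> measurable_fun setT f ->
  measurable_fun setT g -> energy f = energy g.
Proof.
move=> fg mf mg; apply: ae_eq_integral => //.
- by apply/measurable_EFinP/measurable_funX.
- by apply/measurable_EFinP/measurable_funX.
by apply: filterS fg => x /= /[apply] ->.
Qed.

Lemma normL2_ae f g : f = g %[ae mu] -> measurable_fun setT f ->
  measurable_fun setT g -> normL2 f = normL2 g.
Proof. by move=> fg mf mg; rewrite /normL2 !LnormE (energy_eq fg). Qed.

Lemma inL2_ae f g : f = g %[ae mu] -> measurable_fun setT g -> inL2 f -> inL2 g.
Proof.
by move=> fg mg /inL2P[mf ef]; apply/inL2P; rewrite -(energy_eq fg).
Qed.

Lemma normL2_eq0 f : inL2 f -> normL2 f = 0 -> f = (fun=> 0) %[ae mu].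
Proof.
move=> f2 f0; have := LnormE_fin f2; rewrite f0 => /Lnorm_eq0_eq0.
have /measurable_EFinP mf := inL2_measurable f2.
move=> /(_ mf); rewrite lte_fin => /(_ (ltr0n _ _)).
by apply: filterS => x /= /[apply] -[].
Qed.

Lemma normL2D f g : inL2 f -> inL2 g ->
  normL2 (fun x => f x + g x) <= normL2 f + normL2 g.
Proof.
move=> f2 g2; rewrite -lee_fin EFinD -!LnormE_fin ?inL2D//.
by apply: eminkowski => //; [exact: inL2_measurable..|rewrite lee_fin ler1n].
Qed.

Lemma eq_normL2 f g : f =1 g -> normL2 f = normL2 g.
Proof. by move=> /funext ->. Qed.

Lemma normL2N f : normL2 (fun x => - f x) = normL2 f.
Proof.
by rewrite /normL2 !LnormE; congr (fine (_ `^ _)%E);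
  apply: eq_integral => x _; rewrite sqrrN.
Qed.

Lemma normL2B f g : inL2 f -> inL2 g ->
  normL2 (fun x => f x - g x) <= normL2 f + normL2 g.
Proof. by move=> f2 g2; rewrite -(normL2N g); apply: normL2D => //; exact: inL2N. Qed.

Lemma normL2BC f g : normL2 (fun x => f x - g x) = normL2 (fun x => g x - f x).
Proof. by rewrite -normL2N; apply: eq_normL2 => x; rewrite opprB. Qed.

Lemma normL2_trianglel f g h : inL2 f -> inL2 g -> inL2 h ->
  normL2 (fun x => f x - h x) <=
  normL2 (fun x => f x - g x) + normL2 (fun x => g x - h x).
Proof.
move=> f2 g2 h2; rewrite (_ : (fun x => f x - h x) =
   (fun x => (f x - g x) + (g x - h x))); last by apply/funext => x; rewrite subrKA.
by apply: normL2D; exact: inL2B.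
Qed.

Lemma normL2_le_add f g : inL2 f -> inL2 g ->
  normL2 f <= normL2 g + normL2 (fun x => f x - g x).
Proof.
move=> f2 g2; rewrite [X in normL2 X <= _](_ : _ = (fun x => g x + (f x - g x))).
  by apply: normL2D => //; exact: inL2B.
by apply/funext => x; rewrite addrC subrK.
Qed.

Lemma normL2Z k f : inL2 f -> normL2 (fun x => k * f x) = `|k| * normL2 f.
Proof.
move=> f2; apply/eqP; rewrite -(@eqrXn2 _ 2)// ?mulr_ge0 ?normL2_ge0//.
rewrite -eqe; apply/eqP; rewrite normL2_sqr ?inL2Z// exprMn real_normK ?num_real//.
rewrite EFinM normL2_sqr// /energy -ge0_integralZl//; last 3 first.
- by apply/measurable_EFinP/measurable_funX; exact: inL2_measurable.
- by move=> x _; rewrite lee_fin sqr_ge0.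
- by rewrite lee_fin sqr_ge0.
by apply: eq_integral => x _; rewrite -EFinM exprMn.
Qed.

Definition inner f g : R := \int[mu]_x (f x * g x).

Lemma inner_integrable f g : inL2 f -> inL2 g ->
  mu.-integrable setT (EFin \o (fun x => f x * g x)).
Proof. by move=> f2 g2; apply/Lfun1_integrable; exact: Lfun2_mul_Lfun1. Qed.

Lemma inner_sqr f : inL2 f -> inner f f = normL2 f ^+ 2.
Proof.
move=> f2; apply: EFin_inj; rewrite normL2_sqr// /inner /Rintegral fineK.
  by apply: eq_integral => x _; rewrite expr2.
by apply: integrable_fin_num => //; exact: inner_integrable.
Qed.

Lemma innerC f g : inner f g = inner g f.
Proof. by apply: eq_Rintegral => x _; rewrite mulrC. Qed.

Lemma innerBl f g h : inL2 f -> inL2 g -> inL2 h ->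
  inner (fun x => f x - g x) h = inner f h - inner g h.
Proof.
move=> f2 g2 h2; rewrite /inner -RintegralB//; [|exact: inner_integrable..].
by apply: eq_Rintegral => x _; rewrite mulrBl.
Qed.

Lemma innerBr f g h : inL2 f -> inL2 g -> inL2 h ->
  inner h (fun x => f x - g x) = inner h f - inner h g.
Proof. by move=> *; rewrite innerC innerBl// innerC [inner g h]innerC. Qed.

Lemma cauchy_schwarz f g : inL2 f -> inL2 g ->
  `|inner f g| <= normL2 f * normL2 g.
Proof.
move=> f2 g2; have fg := inner_integrable f2 g2.
apply: le_trans (le_normr_Rintegral _ fg) _ => //.
rewrite -lee_fin /Rintegral fineK; last first.
  by apply: integrable_fin_num => //; exact: integrable_norm fg.
rewrite EFinM -!LnormE_fin//.
have := @hoelder _ _ _ mu _ _ 2 2 (inL2_measurable f2) (inL2_measurable g2).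
by rewrite Lnorm1; apply => //; rewrite [RHS]splitr !div1r.
Qed.

End L2.

(** * Completeness of L2 *)

Section convergence.
Context {R : realType}.
Notation mu := (leb R).
Implicit Types f g h : R -> R.

(** Fatou's lemma applied to the squares: balls of L2 are closed under almost
   everywhere convergence. *)
Lemma normL2_fatou (u : nat -> R -> R) f (B : R) : 0 <= B ->
  (forall n, inL2 (u n)) -> measurable_fun setT f ->
  {ae mu, forall x, u n x @[n --> \oo] --> f x} ->
  (forall n, normL2 (u n) <= B) -> inL2 f /\ normL2 f <= B.
Proof.
move=> B0 u2 mf uf uB; apply: energy_le => //.
pose s n (x : R) := (u n x ^+ 2)%:E.
have ms n : measurable_fun setT (s n).
  by apply/measurable_EFinP/measurable_funX; exact: inL2_measurable.
rewrite (_ : energy f = \int[mu]_x limn_einf (s ^~ x))%E; last first.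
  apply: ae_eq_integral => //.
  - by apply/measurable_EFinP/measurable_funX.
  - rewrite (_ : (fun x => limn_einf (s ^~ x)) =
        (fun x => - limn_esup (fun n => - s n x))%E); last first.
      by [].
    apply: measurableT_comp => //; apply: measurable_fun_limn_esup => n.
    exact: (@measurableT_comp _ _ _ _ _ _ -%E _ (s n)).
  apply: filterS uf => x uf _; apply/esym.
  have sx : s ^~ x @ \oo --> (f x ^+ 2)%:E.
    apply: cvg_EFin; first exact: nearW.
    rewrite expr2 (_ : fine \o _ = (fun n => u n x * u n x)); first exact: cvgM.
    by apply/funext => n; rewrite /= expr2.
  by rewrite is_cvg_limn_einfE; [exact/cvg_lim|apply/cvg_ex; exists (f x ^+ 2)%:E].
apply: le_trans (fatou mu measurableT ms _) _.
  by move=> n x _; rewrite lee_fin sqr_ge0.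
rewrite limn_einf_lim; apply: lime_le; first exact: is_cvg_einfs.
apply: nearW => n; apply: (@le_trans _ _ (\int[mu]_x s n x)%E).
  by apply: ereal_inf_lbound; exists n => /=.
by rewrite -/(energy _) -normL2_sqr// lee_fin ler_pXn2r// nnegrE ?normL2_ge0.
Qed.

Lemma normL2_0 : normL2 (fun _ : R => 0 : R) = 0.
Proof. by have := normL2Z 0 (@inL2_0 R); rewrite normr0 !mul0r. Qed.

Lemma normL2_sum (d : nat -> R -> R) n : (forall k, inL2 (d k)) ->
  inL2 (fun x => \sum_(k < n) d k x) /\
  normL2 (fun x => \sum_(k < n) d k x) <= \sum_(k < n) normL2 (d k).
Proof.
move=> d2; elim: n => [|n [IH1 IH2]].
  rewrite big_ord0 (_ : (fun x => _) = (fun=> 0)); last first.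
    by apply/funext => x; rewrite big_ord0.
  by rewrite normL2_0; split => //; exact: inL2_0.
rewrite big_ord_recr/= (_ : (fun x => _) =
    (fun x => \sum_(k < n) d k x + d n x)); last first.
  by apply/funext => x; rewrite big_ord_recr.
split; first exact: inL2D.
by apply: le_trans (normL2D IH1 (d2 n)) _; rewrite lerD2r.
Qed.

(** The partial sums of the increments are bounded in L2, so by monotone
   convergence the series of increments converges absolutely almost everywhere;
   Fatou's lemma turns the pointwise limit into an L2 limit with the expected
   rate. *)
Lemma riesz_fischer_geometric (u : nat -> R -> R) (C q : R) :
  0 <= C -> 0 <= q -> q < 1 ->
  (forall n, inL2 (u n)) ->
  (forall n, normL2 (fun x => u n.+1 x - u n x) <= C * q ^+ n) ->
  exists2 f, inL2 f & forall n, normL2 (fun x => u n x - f x) <= C * q ^+ n / (1 - q).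
Proof.
move=> C0 q0 q1 u2 uC; have q10 : 0 < 1 - q by rewrite subr_gt0.
have geo (D : R) n : 0 <= D -> \sum_(k < n) D * q ^+ k <= D / (1 - q).
  move=> D0; rewrite -mulr_sumr; apply: ler_wpM2l => //.
  rewrite -[leRHS]mul1r ler_pdivlMr// mulrC -opprB mulNr -subrX1 opprB.
  by rewrite lerBlDr lerDl exprn_ge0.
pose d n x : R := `|u n.+1 x - u n x|.
have d2 n : inL2 (d n) /\ normL2 (d n) <= C * q ^+ n.
  have ud2 := inL2B (u2 n.+1) (u2 n).
  have [d2] : inL2 (d n) /\ normL2 (d n) <= 1 * normL2 (fun x => u n.+1 x - u n x).
    apply: inL2_dominated => //.
      by apply: measurableT_comp => //; exact: inL2_measurable.
    by move=> x; rewrite normr_id mul1r.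
  by rewrite mul1r => /le_trans/(_ (uC n)).
pose G n x : R := \sum_(k < n) d k x.
have G2 n : inL2 (G n) by have [] := normL2_sum n (fun k => (d2 k).1).
have GC n : normL2 (G n) <= C / (1 - q).
  have [_ /le_trans] := normL2_sum n (fun k => (d2 k).1); apply.
  by apply: le_trans (geo _ n C0); apply: ler_sum => k _; exact: (d2 k).2.
pose s n x : \bar R := (G n x ^+ 2)%:E.
have Gnd x : {homo (fun n => G n x) : m n / (m <= n)%N >-> m <= n}.
  apply/nondecreasing_seqP => n; rewrite /G big_ord_recr/= lerDl.
  exact: normr_ge0.
have G0 n x : 0 <= G n x by apply: sumr_ge0 => k _; exact: normr_ge0.
have snd x : {homo (fun n => s n x) : m n / (m <= n)%N >-> (m <= n)%E}.
  by move=> m n mn; rewrite lee_fin ler_pXn2r ?nnegrE//; exact: Gnd.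
have ms n : measurable_fun setT (s n).
  by apply/measurable_EFinP/measurable_funX; exact: inL2_measurable.
have s0 n x : (0 <= s n x)%E by rewrite lee_fin sqr_ge0.
have ilim : mu.-integrable setT (fun x => limn (s ^~ x)).
  apply/integrableP; split.
    by apply: (emeasurable_fun_cvg s) => // x _; exact: ereal_nondecreasing_is_cvgn.
  rewrite (_ : \int[mu]_x _ = \int[mu]_x (limn (s ^~ x)))%E; last first.
    apply: eq_integral => x _; rewrite gee0_abs// lime_ge//.
      exact: ereal_nondecreasing_is_cvgn.
    exact: nearW.
  rewrite monotone_convergence//.
  apply: (@le_lt_trans _ _ ((C / (1 - q)) ^+ 2)%:E); last by rewrite ltry.
  apply: lime_le.
    apply: ereal_nondecreasing_is_cvgn => m n mn.
    by apply: ge0_le_integral; [by []|move=> x _; exact: s0|exact: ms|exact: ms|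
      move=> x _; exact: snd].
  apply: nearW => n; rewrite -/(energy (G n)) -normL2_sqr// lee_fin.
  by rewrite ler_pXn2r// nnegrE ?normL2_ge0 ?divr_ge0// ltW.
have ucvg : {ae mu, forall x, cvgn (u ^~ x)}.
  apply: filterS (integrable_ae measurableT ilim) => x /(_ I) xfin.
  have bG n : G n x ^+ 2 <= fine (limn (s ^~ x)).
    rewrite -lee_fin fineK// (cvg_lim _ (ereal_nondecreasing_cvgn (snd x)))//.
    by apply: ereal_sup_ubound; exists n.
  have : cvgn (series (fun n => u n.+1 x - u n x)).
    apply: normed_cvg; rewrite (_ : [normed _] = G ^~ x); last first.
      by apply/funext => n; rewrite /normed_series_of/= /series/= big_mkord.
    apply: nondecreasing_is_cvgn; first exact: Gnd.
    exists (Num.sqrt (fine (limn (s ^~ x)))) => _ [n _ <-].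
    by rewrite -[leLHS]ger0_norm// -sqrtr_sqr; exact: ler_wsqrtr.
  rewrite (_ : (fun n => _) = telescope (u ^~ x))// telescopeK => /cvg_ex[l ul].
  apply/cvg_ex; exists (l + u 0%N x).
  rewrite (_ : u ^~ x = (fun n => (u n x - u 0%N x) + u 0%N x)).
    by apply: cvgD => //; exact: cvg_cst.
  by apply/funext => n; rewrite subrK.
(* an upper limit, to be measurable also where the sequence diverges *)
pose f x := fine (limn_esup (fun n => (u n x)%:E)).
have mf : measurable_fun setT f.
  apply: measurableT_comp => //; apply: measurable_fun_limn_esup => n.
  by apply/measurable_EFinP; exact: inL2_measurable.
have uf : {ae mu, forall x, u n x @[n --> \oo] --> f x}.
  apply: filterS ucvg => x /cvg_ex[l ul].
  have uE : (fun n => (u n x)%:E) @ \oo --> l%:E by apply: cvg_EFin => //; exact: nearW.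
  rewrite /f is_cvg_limn_esupE; last by apply/cvg_ex; exists l%:E.
  by rewrite (cvg_lim _ uE).
have uu n m : normL2 (fun x => u n x - u (m + n)%N x) <= C * q ^+ n / (1 - q).
  rewrite normL2BC.
  have ud2 k : inL2 (fun x => u (k + n).+1 x - u (k + n)%N x) by exact: inL2B.
  have [_] := normL2_sum m ud2.
  rewrite (_ : (fun x => _) = (fun x => u (m + n)%N x - u n x)); last first.
    apply/funext => x; elim: m => [|m IH]; first by rewrite big_ord0 subrr.
    by rewrite big_ord_recr/= IH addSn addrC subrKA.
  move/le_trans; apply; apply: le_trans (geo _ m _); last first.
    by rewrite mulr_ge0// exprn_ge0.
  by apply: ler_sum => k _; rewrite -mulrA -exprD addnC; exact: uC.
have {}uu n : inL2 (fun x => u n x - f x) /\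
    normL2 (fun x => u n x - f x) <= C * q ^+ n / (1 - q).
  apply: (@normL2_fatou (fun m x => u n x - u (m + n)%N x)) => //.
  - by rewrite divr_ge0 ?(ltW q10)// mulr_ge0// exprn_ge0.
  - by move=> m; exact: inL2B.
  - by apply: measurable_funB => //; exact: inL2_measurable.
  - apply: filterS uf => x uf; apply: cvgB; first exact: cvg_cst.
    by rewrite (cvg_shiftn n (u ^~ x)).
exists f => [|n]; last exact: (uu n).2.
rewrite (_ : f = (fun x => u 0%N x - (u 0%N x - f x))); last first.
  by apply/funext => x; rewrite subKr.
by apply: inL2B => //; exact: (uu 0%N).1.
Qed.

Theorem L2_complete (u : nat -> R -> R) : (forall n, inL2 (u n)) ->
  (forall e, 0 < e -> exists N, forall m n, (N <= m)%N -> (N <= n)%N ->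
     normL2 (fun x => u m x - u n x) <= e) ->
  exists2 f, inL2 f & normL2 (fun x => u n x - f x) @[n --> \oo] --> 0.
Proof.
move=> u2 uC.
have /choice[N NP] k : exists N, forall m n, (N <= m)%N -> (N <= n)%N ->
    normL2 (fun x => u m x - u n x) <= 2^-1 ^+ k.
  by apply: uC; rewrite exprn_gt0// invr_gt0.
(* a sum, so that both s k and s k.+1 are at least N k *)
pose s k := (\sum_(i < k.+1) N i)%N.
have Ns k : (N k <= s k)%N by rewrite /s big_ord_recr/= leq_addl.
have Ns1 k : (N k <= s k.+1)%N.
  by rewrite /s big_ord_recr/= (leq_trans (Ns k))// leq_addr.
have half : 1 - 2^-1 = 2^-1 :> R by lra.
have [|||||f f2 fs] := riesz_fischer_geometric (u := fun k => u (s k)) (C := 1) (q := 2^-1).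
- by [].
- by rewrite invr_ge0.
- by rewrite invf_lt1// ltr1n.
- by [].
- by move=> k; rewrite mul1r; exact: NP.
exists f => //; apply/cvgrPdist_le => e e0.
(* 1 for the distance to the subsequence, 2 for that of the subsequence to f *)
have [k ke] : exists k, 3 * 2^-1 ^+ k <= e.
  have : (fun k => 3 * 2^-1 ^+ k : R) @ \oo --> 0.
    by apply: cvg_geometric; rewrite ger0_norm// invf_lt1// ltr1n.
  move=> /cvgrPdist_le/(_ e e0)[k _ /(_ k (leqnn k))].
  by rewrite sub0r normrN ger0_norm ?mulr_ge0 ?exprn_ge0 ?invr_ge0//; exists k.
exists (N k) => // m /= Nm; rewrite sub0r normrN ger0_norm ?normL2_ge0//.
apply: le_trans (normL2_trianglel (u2 m) (u2 (s k)) f2) _.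
apply: le_trans ke; rewrite -[3]/(1 + 2) mulrDl mul1r lerD//; first exact: NP.
by apply: le_trans (fs k) _; rewrite half invrK mul1r mulrC.
Qed.

End convergence.

(** * Functions of two variables *)

Section measurability.
Context {R : realType}.
Notation mu := (leb R).
Local Open Scope ereal_scope.

Lemma ge0_le_integralT (f g : R -> \bar R) : (forall x, 0 <= f x) ->
  measurable_fun setT f -> measurable_fun setT g -> (forall x, f x <= g x) ->
  \int[mu]_x f x <= \int[mu]_x g x.
Proof.
move=> f0 mf mg fg.
by apply: ge0_le_integral; [by []|move=> x _; exact: f0|exact: mf|exact: mg|
  move=> x _; exact: fg].
Qed.

(** The integral is the difference of those of the positive and negative parts,
   and Tonelli's theorem applies to each. *)
Lemma measurable_integral2 (f : R * R -> \bar R) : measurable_fun setT f ->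
  measurable_fun setT (fun x => \int[mu]_y f (x, y)).
Proof.
move=> mf; rewrite (_ : (fun x => _) =
    (fun x => \int[mu]_y f^\+ (x, y) - \int[mu]_y f^\- (x, y))); last first.
  apply/funext => x; rewrite integralE; congr (_ - _); apply: eq_integral => y _.
    by rewrite !funeposE.
  by rewrite !funenegE.
apply: emeasurable_funB.
  apply: (@measurable_fun_fubini_tonelli_F _ _ _ _ _ mu (f^\+)) => //.
  exact: measurable_funepos.
apply: (@measurable_fun_fubini_tonelli_F _ _ _ _ _ mu (f^\-)) => //.
exact: measurable_funeneg.
Qed.

Lemma measurable_Rintegral2 (f : R * R -> R) : measurable_fun setT f ->
  measurable_fun setT (fun x => (\int[mu]_y f (x, y))%R).
Proof.
move=> mf; apply: measurableT_comp => //.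
by apply: (@measurable_integral2 (EFin \o f)); exact/measurable_EFinP.
Qed.

Lemma tonelli (f : R * R -> \bar R) : measurable_fun setT f ->
  (forall z, 0 <= f z) ->
  \int[mu]_x \int[mu]_y f (x, y) = \int[mu]_y \int[mu]_x f (x, y).
Proof. by move=> mf f0; exact: (@fubini_tonelli _ _ _ _ R mu mu f). Qed.

Lemma integrable_mul_bounded (f k : R -> R) (B : R) :
  mu.-integrable setT (EFin \o f) -> measurable_fun setT k ->
  (forall x, (`|k x| <= B)%R) -> mu.-integrable setT (EFin \o (fun x => f x * k x)%R).
Proof.
move=> fi mk kB; have mf : measurable_fun setT f.
  by apply/measurable_EFinP; case/integrableP : fi.
have iB : mu.-integrable setT (EFin \o (fun x => f x * B)%R).
  rewrite (_ : EFin \o _ = (fun x => B%:E * (EFin \o f) x)).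
    exact: integrableZl.
  by apply/funext => x; rewrite /= mulrC EFinM.
apply: (le_integrable _ _ _ iB) => //.
  by apply/measurable_EFinP; exact: measurable_funM.
move=> p _; rewrite /= !normrM !lee_fin ler_wpM2l//.
by apply: le_trans (kB p) _; exact: ler_norm.
Qed.

(** The form of Fubini's theorem behind all the identities below: the symmetry
   of the Hartley transform and the computation of its damped energy. *)
Lemma fubini_bilinear (f g : R -> R) (k : R * R -> R) (B : R) :
  mu.-integrable setT (EFin \o f) -> mu.-integrable setT (EFin \o g) ->
  measurable_fun setT k -> (forall z, (`|k z| <= B)%R) ->
  (\int[mu]_x (f x * \int[mu]_y (g y * k (x, y))) =
   \int[mu]_y (g y * \int[mu]_x (f x * k (x, y))))%R.
Proof.
move=> fi gi mk kB.
have B0 : (0 <= B)%R by apply: le_trans (kB (0, 0)%R).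
have mf : measurable_fun setT f by apply/measurable_EFinP; case/integrableP : fi.
have mg : measurable_fun setT g by apply/measurable_EFinP; case/integrableP : gi.
have mk1 x : measurable_fun setT (fun y : R => k (x, y)).
  by apply: measurableT_comp => //; exact: measurable_pair1.
have mk2 y : measurable_fun setT (fun x : R => k (x, y)).
  by apply: measurableT_comp => //; exact: measurable_pair2.
pose F (z : R * R) : \bar R := (f z.1 * g z.2 * k z)%:E.
have mF : measurable_fun setT F.
  apply/measurable_EFinP; apply: measurable_funM => //.
  apply: measurable_funM; first exact: (measurableT_comp mf).
  exact: (measurableT_comp mg).
have maf : measurable_fun setT (fun x : R => `|(f x)%:E|).
  by apply: measurableT_comp => //; apply/measurable_EFinP.
have mag : measurable_fun setT (fun x : R => `|(g x)%:E|).
  by apply: measurableT_comp => //; apply/measurable_EFinP.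
have mBag : measurable_fun setT (fun y : R => B%:E * `|(g y)%:E|).
  exact: emeasurable_funM.
have iF : (mu \x mu).-integrable setT F.
  apply/integrable12ltyP => //.
  have [/integrableP[_ If] /integrableP[_ Ig]] := (fi, gi).
  have mF1 x : measurable_fun setT (fun y => F (x, y)).
    by apply: measurableT_comp => //; exact: measurable_pair1.
  apply: (@le_lt_trans _ _ (\int[mu]_x (`|(f x)%:E| * (B%:E * \int[mu]_y `|(g y)%:E|)))).
    apply: ge0_le_integralT.
    - by move=> x; apply: integral_ge0.
    - apply: (@measurable_integral2 (fun z => `|F z|)).
      exact: measurableT_comp.
    - by apply: emeasurable_funM => //; apply: measurable_cst.
    move=> x; rewrite -ge0_integralZl//.
    rewrite -ge0_integralZl//; last by move=> y _; rewrite mule_ge0// lee_fin.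
    apply: ge0_le_integralT => //.
    - by apply: measurableT_comp => //; exact: mF1.
    - by apply: emeasurable_funM => //.
    move=> y; rewrite /F /= -!EFinM lee_fin !normrM -mulrA ler_wpM2l// mulrC.
    by rewrite ler_wpM2r.
  rewrite ge0_integralZr//; last first.
  - by rewrite mule_ge0// integral_ge0.
  apply: lte_mul_pinfty => //; first exact: integral_ge0.
    by rewrite ge0_fin_numE// integral_ge0.
  by rewrite lte_mul_pinfty// ?fin_numE.
have H1 (x : R) : (f x * \int[mu]_y (g y * k (x, y)))%R%:E = \int[mu]_y F (x, y).
  have ig := integrable_mul_bounded gi (mk1 x) (fun y => kB (x, y)).
  rewrite -RintegralZl// /Rintegral fineK.
    by apply: eq_integral => y _; rewrite /F/= mulrA.
  apply: integrable_fin_num => //.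
  rewrite (_ : (fun y => _) = (fun y => (f x)%:E * (EFin \o (fun y : R => g y * k (x, y)))%R y)).
    exact: integrableZl.
  by apply/funext => y; rewrite /= EFinM.
have H2 (y : R) : (g y * \int[mu]_x (f x * k (x, y)))%R%:E = \int[mu]_x F (x, y).
  have if_ := integrable_mul_bounded fi (mk2 y) (fun x => kB (x, y)).
  rewrite -RintegralZl// /Rintegral fineK.
    by apply: eq_integral => x _; rewrite /F/= mulrA (mulrC (g y)).
  apply: integrable_fin_num => //.
  rewrite (_ : (fun y => _) = (fun x => (g y)%:E * (EFin \o (fun x : R => f x * k (x, y)))%R x)).
    exact: integrableZl.
  by apply/funext => x; rewrite /= EFinM.
rewrite /Rintegral -/(Rintegral _ _); congr fine.
transitivity (\int[mu]_x \int[mu]_y F (x, y)); first by apply: eq_integral => x _; exact: H1.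
transitivity (\int[mu]_y \int[mu]_x F (x, y)); last by apply: eq_integral => y _; rewrite -H2.
exact: (Fubini iF).
Qed.

End measurability.

(** * Reflections and translations *)

Section reflection.
Context {R : realType}.
Notation mu := (leb R).

(** Lebesgue measure is determined by half-open intervals; a translation is
   a product of two reflections, so this case is enough. *)
Lemma lebesgue_measure_reflect (c : R) (A : set R) : measurable A ->
  pushforward mu (fun x : R => c - x : measurableTypeR R) A = mu A.
Proof.
move=> mA.
have mc : measurable_fun setT (fun x : R => c - x : measurableTypeR R).
  exact: measurable_funB.
pose mc_mixin := isMeasurableFun.Build _ _ _ _ _ mc.
pose mc_pack : {mfun _ >-> _} := HB.pack (fun x : R => c - x : measurableTypeR R) mc_mixin.
apply/esym/(@lebesgue_measure_unique _ (pushforward mu mc_pack)) => //= _ [[a b]] _ <-.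
rewrite /pushforward (_ : _ @^-1` _ = `[c - b, c - a[%classic); last first.
  apply/seteqP; split => x /=; rewrite !in_itv/=; lra.
rewrite !lebesgue_measure_itv/= !lte_fin.
rewrite ltrD2l ltrN2; case: ifPn => // _; rewrite -!EFinD; congr _%:E; ring.
Qed.

Lemma integral_reflect (c : R) (f : R -> \bar R) : measurable_fun setT f ->
  (forall x, (0 <= f x)%E) -> (\int[mu]_x f (c - x)%R = \int[mu]_x f x)%E.
Proof.
move=> mf f0.
pose phi (x : measurableTypeR R) : measurableTypeR R := c - x.
have mphi : measurable_fun setT phi by exact: measurable_funB.
rewrite [LHS](_ : _ = \int[mu]_(x in phi @^-1` setT) (f \o phi) x)%E; last first.
  by rewrite preimage_setT.
rewrite -ge0_integral_pushforward//.
by apply: eq_measure_integral => A mA _; exact: lebesgue_measure_reflect.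
Qed.

Lemma integral_translate (c : R) (f : R -> \bar R) : measurable_fun setT f ->
  (forall x, (0 <= f x)%E) -> (\int[mu]_x f (x - c)%R = \int[mu]_x f x)%E.
Proof.
move=> mf f0; rewrite -[RHS](integral_reflect (- c)) //.
rewrite -[RHS](integral_reflect 0) => [||x]; [| |exact: f0]; last first.
  by apply: measurableT_comp => //; exact: measurable_funB.
by apply: eq_integral => x _; congr f; ring.
Qed.

End reflection.

(** * Young's inequality *)

Section young.
Context {R : realType}.
Notation mu := (leb R).
Implicit Types f g K G : R -> R.

(** Cauchy-Schwarz in extended reals, for functions not known to be in L2. *)
Lemma cauchy_schwarz_energy f g : measurable_fun setT f -> measurable_fun setT g ->
  ((\int[mu]_x `|f x * g x|%:E) `^ 2%:R <= energy f * energy g)%E.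
Proof.
move=> mf mg; have := @hoelder _ _ _ mu _ _ 2 2 mf mg.
have h : 2^-1 + 2^-1 = 1 :> R by lra.
rewrite Lnorm1 => /(_ (ltr0n _ _) (ltr0n _ _) h); rewrite !LnormE => H.
have P : (0 <= \int[mu]_x `|f x * g x|%:E)%E.
  by apply: integral_ge0 => x _; rewrite lee_fin.
apply: (@le_trans _ _ ((energy f `^ 2^-1 * energy g `^ 2^-1) `^ 2%:R)%E).
  by apply: gt0_ler_poweR => //; rewrite in_itv/= leey andbT ?mule_ge0 ?poweR_ge0.
rewrite poweRM ?poweR_ge0// -!poweRrM mulVf// !poweRe1// energy_ge0//.
Qed.

(** By Cauchy-Schwarz |K * G|^2 <= |K|_1 (|K| * G^2) pointwise, and the integral
   of |K| * G^2 is |K|_1 |G|^2 by Tonelli's theorem and translation invariance.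
   Finiteness of that integral also makes the convolution integral converge for
   almost every x, without which convolution would not be additive. *)
Lemma young K G : measurable_fun setT K -> (\int[mu]_x `|K x|%:E < +oo)%E ->
  inL2 G ->
  [/\ inL2 (fun x => \int[mu]_y (K (x - y) * G y)),
      normL2 (fun x => \int[mu]_y (K (x - y) * G y)) <= (\int[mu]_x `|K x|) * normL2 G &
      {ae mu, forall x, mu.-integrable setT (EFin \o (fun y => K (x - y) * G y))}].
Proof.
move=> mK K1 G2; have mG := inL2_measurable G2.
set k := \int[mu]_x `|K x|.
have kE : (\int[mu]_x `|K x|%:E)%E = k%:E.
  by rewrite /k /Rintegral fineK// ge0_fin_numE// integral_ge0.
have k0 : 0 <= k by exact: Rintegral_ge0.
have mxy : measurable_fun setT (fun z : R * R => z.1 - z.2) by exact: measurable_funB.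
have mKxy : measurable_fun setT (fun z : R * R => K (z.1 - z.2)).
  exact: (measurableT_comp mK).
have mGy : measurable_fun setT (fun z : R * R => G z.2).
  exact: (measurableT_comp mG).
have mKx (x : R) : measurable_fun setT (fun y : R => K (x - y)).
  by apply: measurableT_comp => //; exact: measurable_funB.
have mKG (x : R) : measurable_fun setT (fun y : R => (K (x - y) * G y)%:E).
  by apply/measurable_EFinP; exact: measurable_funM.
pose A (x : R) := (\int[mu]_y (`|K (x - y)| * G y ^+ 2)%R%:E)%E.
have mAxy : measurable_fun setT (fun z : R * R => (`|K (z.1 - z.2)| * G z.2 ^+ 2)%:E).
  apply/measurable_EFinP; apply: measurable_funM; last exact: measurable_funX.
  exact: measurableT_comp.
have mA : measurable_fun setT A by exact: (measurable_integral2 mAxy).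
have A0 x : (0 <= A x)%E.
  by apply: integral_ge0 => y _; rewrite lee_fin mulr_ge0// sqr_ge0.
have intA : (\int[mu]_x A x = k%:E * energy G)%E.
  transitivity (\int[mu]_y \int[mu]_x (`|K (x - y)| * G y ^+ 2)%R%:E)%E.
    by apply: (tonelli mAxy) => z; rewrite lee_fin mulr_ge0// sqr_ge0.
  rewrite /energy -ge0_integralZl//; last 2 first.
  - by apply/measurable_EFinP/measurable_funX.
  - by move=> x _; rewrite lee_fin sqr_ge0.
  apply: eq_integral => y _; under eq_integral do rewrite mulrC EFinM.
  rewrite ge0_integralZl//; last 2 first.
  - apply/measurable_EFinP; apply: measurableT_comp => //.
    by apply: measurableT_comp => //; exact: measurable_funB.
  - by rewrite lee_fin sqr_ge0.
  rewrite muleC (integral_translate y (f := fun x : R => `|K x|%:E)) ?kE//.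
  by apply/measurable_EFinP; exact: measurableT_comp.
(* Cauchy-Schwarz after splitting K into two square roots *)
have key (x : R) : ((\int[mu]_y `|(K (x - y) * G y)%:E|) `^ 2%:R <= k%:E * A x)%E.
  pose f (y : R) : R := Num.sqrt `|K (x - y)|; pose g (y : R) : R := f y * G y.
  have mf : measurable_fun setT f.
    have msqrt : measurable_fun setT (@Num.sqrt R).
      by apply: continuous_measurable_fun; exact: sqrt_continuous.
    have mnK : measurable_fun setT (fun y : R => `|K (x - y)|) by exact: measurableT_comp.
    exact: (measurableT_comp msqrt mnK).
  have mg : measurable_fun setT g by exact: measurable_funM.
  have := cauchy_schwarz_energy mf mg.
  have -> : energy f = k%:E.
    rewrite -kE -(integral_reflect x); last 2 first.
    - by apply/measurable_EFinP; exact: measurableT_comp.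
    - by move=> y; rewrite lee_fin.
    by apply: eq_integral => y _; rewrite sqr_sqrtr.
  have -> : energy g = A x.
    by apply: eq_integral => y _; rewrite /g exprMn sqr_sqrtr.
  suff -> : (\int[mu]_y `|f y * g y|%:E = \int[mu]_y `|(K (x - y) * G y)%:E|)%E by [].
  apply: eq_integral => y _; rewrite /g mulrA -expr2 sqr_sqrtr//.
  by rewrite /= normrM normr_id -normrM.
have mconv : measurable_fun setT (fun x : R => \int[mu]_y (K (x - y) * G y)).
  apply: (@measurable_Rintegral2 _ (fun z : R * R => K (z.1 - z.2) * G z.2)).
  exact: measurable_funM.
have [c2 cn] : inL2 (fun x => \int[mu]_y (K (x - y) * G y)) /\
    normL2 (fun x => \int[mu]_y (K (x - y) * G y)) <= k * normL2 G.
  apply: energy_le => //; first by rewrite mulr_ge0// normL2_ge0.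
  rewrite exprMn expr2 -mulrA EFinM [X in (_ * X)%E]EFinM normL2_sqr// -intA.
  rewrite -ge0_integralZl//.
  apply: ge0_le_integralT.
  - by move=> x; rewrite lee_fin sqr_ge0.
  - by apply/measurable_EFinP/measurable_funX.
  - exact: measurable_funeM.
  move=> x; apply: le_trans (key x).
  rewrite -[in leLHS]real_normK ?num_real// -powR_mulrn// -poweR_EFin.
  apply: gt0_ler_poweR => //.
  - by rewrite in_itv/= leey andbT lee_fin.
  - by rewrite in_itv/= leey andbT integral_ge0.
  apply: le_trans (le_abse_integral mu measurableT (mKG x)).
  by rewrite /Rintegral; case: (\int[mu]_y _)%E => [r||] //=; rewrite normr0 leey.
split => //.
have Ai : mu.-integrable setT A.
  apply/integrableP; split=> //.
  under eq_integral do rewrite gee0_abs//.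
  by rewrite intA -normL2_sqr// ltry.
apply: filterS (integrable_ae measurableT Ai) => x /(_ I) Ax.
apply/integrableP; split; first exact: mKG.
apply: (@lty_poweRy _ _ 2%:R) => //; apply: le_lt_trans (key x) _.
by rewrite ltey_eq fin_numM.
Qed.

End young.

(** * Integration of even functions *)

Section half_line.
Context {R : realType}.
Notation mu := (leb R).

Lemma integral_half_line (f F : R -> R) (l : R) :
  (forall x, 0 <= f x) -> continuous f -> (forall x : R, is_derive x 1 F (f x)) ->
  F x @[x --> +oo] --> l ->
  (\int[mu]_(x in `[0%R, +oo[) (f x)%:E = (l - F 0)%:E)%E.
Proof.
move=> f0 cf dF Fl; rewrite EFinB; apply: ge0_continuous_FTC2y => //.
- exact: continuous_subspaceT.
- apply: cvg_at_right_filter; apply: differentiable_continuous.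
  exact/derivable1_diffP.
- by move=> x _; rewrite derive1E; exact: derive_val.
Qed.

(** F is an antiderivative of g, which is f on the positive half-line but may be
   smooth where f is not. *)
Lemma integral_even (f g F : R -> R) (l : R) :
  (forall x, 0 <= f x) -> continuous f -> (forall x, f (- x) = f x) ->
  (forall x, 0 <= x -> f x = g x) -> (forall x, 0 <= g x) -> continuous g ->
  (forall x : R, is_derive x 1 F (g x)) -> F x @[x --> +oo] --> l ->
  (\int[mu]_x (f x)%:E = (2 * (l - F 0))%:E)%E.
Proof.
move=> f0 cf fN fg g0 cg dF Fl.
rewrite ge0_symfun_integralT//; last by move=> x; rewrite /= fN.
rewrite -set_itvcy EFinM; congr (_ * _)%E.
rewrite -(integral_half_line g0 cg dF Fl); apply: eq_integral => x.
by rewrite inE/= in_itv/= andbT => x0; rewrite fg.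
Qed.

Lemma Rintegral_reflect (c : R) (f : R -> R) : measurable_fun setT f ->
  \int[mu]_x f (c - x) = \int[mu]_x f x.
Proof.
move=> mf; congr fine; rewrite integralE [RHS]integralE.
have mEf : measurable_fun setT (EFin \o f) by exact/measurable_EFinP.
congr (_ - _)%E.
  rewrite -[RHS](integral_reflect c) => [||x]; [|exact: measurable_funepos|exact: funepos_ge0].
  by apply: eq_integral => x _; rewrite !funeposE.
rewrite -[RHS](integral_reflect c) => [||x]; [|exact: measurable_funeneg|exact: funeneg_ge0].
by apply: eq_integral => x _; rewrite !funenegE.
Qed.

End half_line.

(** * The Poisson kernel *)

Section poisson.
Context {R : realType}.
Notation mu := (leb R).
Variable e : R.
Hypothesis e0 : 0 < e.

Definition damp (p : R) : R := expR (- (e * `|p|)).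

Lemma damp_ge0 p : 0 <= damp p. Proof. exact: expR_ge0. Qed.

Lemma damp_le1 p : damp p <= 1.
Proof. by rewrite -expR0 ler_expR oppr_le0 mulr_ge0// ltW. Qed.

Lemma continuous_damp : continuous damp.
Proof.
move=> x; apply: continuous_comp; last exact: continuous_expR.
apply: cvgN; apply: cvgM; first exact: cvg_cst.
exact: norm_continuous.
Qed.

Lemma measurable_damp : measurable_fun setT damp.
Proof. by apply: continuous_measurable_fun; exact: continuous_damp. Qed.

Definition poisson (t : R) : R := 2 * e / (e ^+ 2 + t ^+ 2).

Lemma poisson_den_gt0 (t : R) : 0 < e ^+ 2 + t ^+ 2.
Proof. by rewrite ltr_pwDl ?sqr_ge0// exprn_gt0. Qed.

Lemma poisson_ge0 t : 0 <= poisson t.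
Proof. by rewrite divr_ge0 ?mulr_ge0 ?(ltW e0)// ltW// poisson_den_gt0. Qed.

Lemma poisson_le t : poisson t <= 2 / e.
Proof.
rewrite ler_pdivlMr// /poisson mulrAC ler_pdivrMr ?poisson_den_gt0//.
rewrite -mulrA -expr2 ler_pM2l// lerDl sqr_ge0//.
Qed.

Lemma cos_mul_continuous (t : R) : continuous (fun p : R => cos (t * p)).
Proof.
move=> x; apply: continuous_comp; last exact: continuous_cos.
by apply: cvgM; [exact: cvg_cst|exact: cvg_id].
Qed.

Lemma sin_mul_continuous (t : R) : continuous (fun p : R => sin (t * p)).
Proof.
move=> x; apply: continuous_comp; last exact: continuous_sin.
by apply: cvgM; [exact: cvg_cst|exact: cvg_id].
Qed.

Lemma cvg_expR_mul : expR (- (e * p)) @[p --> +oo] --> (0 : R).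
Proof.
apply: (@cvg_comp _ _ _ (fun p => e * p) (fun z => expR (- z)) _ (pinfty_nbhs R)).
  by apply: gt0_cvgMry.
exact: cvgr_expR.
Qed.

(** The summand 1 makes the integrand nonnegative, as the improper form of the
   fundamental theorem of calculus requires. *)
Lemma integral_damp_cos1 (t : R) :
  (\int[mu]_p (damp p * (1 + cos (t * p)))%:E = (2 / e + poisson t)%:E)%E.
Proof.
have D0 := poisson_den_gt0 t.
have c1 x : 0 <= 1 + cos x :> R by rewrite -lerBlDl sub0r; exact: cos_geN1.
pose E (p : R) : R := expR (- (e * p)).
(* E * W is the antiderivative vanishing at infinity *)
pose W (p : R) : R := (t * sin (t * p) - e * cos (t * p)) / (e ^+ 2 + t ^+ 2) - e^-1.
pose g (p : R) : R := E p * (1 + cos (t * p)).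
have cE : continuous E.
  move=> x; apply: continuous_comp; last exact: continuous_expR.
  by apply: cvgN; apply: cvgM; [exact: cvg_cst|exact: cvg_id].
have cc : continuous (fun p : R => 1 + cos (t * p)).
  by move=> x; apply: cvgD; [exact: cvg_cst|exact: cos_mul_continuous].
have -> : 2 / e + poisson t = 2 * (0 - (E \* W) 0).
  rewrite /= /E /W !mulr0 oppr0 expR0 sin0 cos0 /poisson.
  by field; rewrite !gt_eqF.
apply: (@integral_even _ _ g).
- by move=> x; rewrite mulr_ge0// damp_ge0.
- by move=> x; apply: cvgM; [exact: continuous_damp|exact: cc].
- by move=> x; rewrite /damp normrN mulrN cosN.
- by move=> x x0; rewrite /damp ger0_norm.
- by move=> x; rewrite mulr_ge0// expR_ge0.
- by move=> x; apply: cvgM; [exact: cE|exact: cc].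
- move=> x.
  have dZ (k d : R) (h : R -> R) : is_derive x 1 h d ->
      is_derive x 1 (fun p => k * h p) (k * d).
    by move=> dh; exact: (is_deriveZ k dh).
  have dl (k : R) : is_derive x 1 (fun p : R => k * p) k.
    by rewrite -[k in is_derive _ _ _ k]mulr1; apply: dZ; exact: is_derive_id.
  have dE : is_derive x 1 E (E x * (- e)).
    exact: (@is_derive1_comp _ expR (fun p => - (e * p)) x _ _
      (is_derive_expR _) (is_deriveN (dl e))).
  have ds : is_derive x 1 (fun p : R => sin (t * p)) (cos (t * x) * t).
    exact: (@is_derive1_comp _ sin (fun p => t * p) x _ _ (is_derive_sin _) (dl t)).
  have dc : is_derive x 1 (fun p : R => cos (t * p)) (- sin (t * x) * t).
    exact: (@is_derive1_comp _ cos (fun p => t * p) x _ _ (is_derive_cos _) (dl t)).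
  have dW : is_derive x 1 W ((e ^+ 2 + t ^+ 2)^-1 *
      (t * (cos (t * x) * t) - e * (- sin (t * x) * t)) - 0).
    rewrite (_ : W = (fun p => (e ^+ 2 + t ^+ 2)^-1 *
      (t * sin (t * p) - e * cos (t * p))) - cst e^-1); last first.
      by apply/funext => p; rewrite /W mulrC.
    have dV := is_deriveB (dZ t _ _ ds) (dZ e _ _ dc).
    exact: (is_deriveB (dZ (e ^+ 2 + t ^+ 2)^-1 _ _ dV) (is_derive_cst e^-1 x 1)).
  apply: (is_derive_eq (is_deriveM dE dW)); rewrite /GRing.scale/= /g /W; field.
  by rewrite !gt_eqF.
- apply: norm_cvg0.
  pose B : R := (`|t| + e) / (e ^+ 2 + t ^+ 2) + e^-1.
  apply: (@squeeze_cvgr _ _ _ _ (fun=> 0) (fun p => E p * B)).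
  + apply: nearW => p; rewrite normr_ge0/= normrM ger0_norm ?expR_ge0//.
    rewrite ler_wpM2l ?expR_ge0// /W /B.
    have ei : 0 <= e^-1 by rewrite invr_ge0 ltW.
    have Di : 0 <= (e ^+ 2 + t ^+ 2)^-1 by rewrite invr_ge0 ltW.
    apply: le_trans (ler_normB _ _) _; rewrite (ger0_norm ei).
    rewrite lerD2r normrM (ger0_norm Di) ler_wpM2r//.
    apply: le_trans (ler_normB _ _) _.
    rewrite !normrM (gtr0_norm e0) lerD//.
      by rewrite ler_piMr// sin_max.
    by apply: ler_piMr; [exact: ltW|exact: cos_max].
  + exact: cvg_cst.
  + by rewrite -(mul0r B); apply: cvgM; [exact: cvg_expR_mul|exact: cvg_cst].
Qed.

Lemma integrable_damp : mu.-integrable setT (EFin \o damp).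
Proof.
apply/integrableP; split; first by apply/measurable_EFinP; exact: measurable_damp.
have := integral_damp_cos1 0; under eq_integral do rewrite mul0r cos0.
rewrite (_ : (fun x => _) = (fun x => 2%:E * (damp x)%:E)%E); last first.
  by apply/funext => x; rewrite -EFinM mulrC.
rewrite ge0_integralZl//; last 2 first.
- by apply/measurable_EFinP; exact: measurable_damp.
- by move=> x _; rewrite lee_fin damp_ge0.
move=> H; rewrite (_ : \int[mu]_x _ = \int[mu]_x (damp x)%:E)%E; last first.
  by apply: eq_integral => x _; rewrite /= ger0_norm// damp_ge0.
rewrite ltey; apply/eqP => oo; move: H; rewrite oo.
by rewrite mulry gtr0_sg// mul1e.
Qed.

(** Up to normalization the Poisson kernel is the cosine transform of the damping
   factor; the sine term is odd and integrates to 0. *)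
Lemma integral_damp_cos_sin (t s : R) :
  \int[mu]_p (damp p * (cos (t * p) + sin (s * p))) = poisson t.
Proof.
have mc (r : R) : measurable_fun setT (fun p : R => cos (r * p)).
  by apply: continuous_measurable_fun; exact: cos_mul_continuous.
have ms : measurable_fun setT (fun p : R => sin (s * p)).
  by apply: continuous_measurable_fun; exact: sin_mul_continuous.
have ic (r : R) : mu.-integrable setT (EFin \o (fun p => damp p * cos (r * p))).
  by apply: (integrable_mul_bounded (B := 1) integrable_damp) => // p; exact: cos_max.
have isin : mu.-integrable setT (EFin \o (fun p => damp p * sin (s * p))).
  by apply: (integrable_mul_bounded (B := 1) integrable_damp) => // p; exact: sin_max.
have c1 (r : R) : \int[mu]_p damp p + \int[mu]_p (damp p * cos (r * p)) = 2 / e + poisson r.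
  rewrite -RintegralD//; last exact: integrable_damp.
  apply: EFin_inj; rewrite -integral_damp_cos1 /Rintegral fineK.
    by apply: eq_integral => p _; rewrite mulrDr mulr1.
  under eq_integral do rewrite -{1}(mulr1 (damp _)) -mulrDr.
  by rewrite integral_damp_cos1.
have d0 : \int[mu]_p damp p = 2 / e.
  have := c1 0; under [X in _ + X]eq_Rintegral do rewrite mul0r cos0 mulr1.
  rewrite (_ : poisson 0 = 2 / e); first lra.
  by rewrite /poisson expr0n addr0; field; rewrite gt_eqF.
have s0 : \int[mu]_p (damp p * sin (s * p)) = 0.
  have mf : measurable_fun setT (fun p => damp p * sin (s * p)).
    by apply: measurable_funM => //; exact: measurable_damp.
  suff : \int[mu]_p (damp p * sin (s * p)) = - \int[mu]_p (damp p * sin (s * p)).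
    by lra.
  rewrite -[LHS](Rintegral_reflect 0 mf) -mulN1r -RintegralZl//.
  apply: eq_Rintegral => p _.
  by rewrite sub0r /damp normrN mulrN sinN mulrN mulN1r.
under eq_Rintegral do rewrite mulrDr.
by rewrite RintegralD// s0 addr0; have := c1 t; rewrite d0 => /addrI.
Qed.

Lemma continuous_poisson : continuous poisson.
Proof.
move=> t; apply: cvgM; first exact: cvg_cst.
apply: cvgV; first by rewrite gt_eqF// poisson_den_gt0.
apply: cvgD; first exact: cvg_cst.
exact: exprn_continuous.
Qed.

Lemma measurable_poisson : measurable_fun setT poisson.
Proof. by apply: continuous_measurable_fun; exact: continuous_poisson. Qed.

Let is_derive_atan_scaled (t : R) :
  is_derive t 1 (fun t => 2 * atan (e^-1 * t)) (poisson t).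
Proof.
have dl : is_derive t 1 (fun t : R => e^-1 * t) e^-1.
  rewrite -[X in is_derive _ _ _ X]mulr1; exact: (is_deriveZ e^-1 (is_derive_id t 1)).
have da := @is_derive1_comp _ atan (fun t => e^-1 * t) t _ _ (is_derive1_atan _) dl.
apply: (is_derive_eq (is_deriveZ 2 da)); rewrite /GRing.scale/= /poisson; field.
by rewrite !gt_eqF ?poisson_den_gt0.
Qed.

Lemma integral_poisson : (\int[mu]_t (poisson t)%:E = (2 * pi)%:E)%E.
Proof.
rewrite (_ : 2 * pi = 2 * (2 * (pi / 2) - 2 * atan (e^-1 * 0))); last first.
  by rewrite mulr0 atan0; field.
apply: (@integral_even _ poisson poisson (fun t => 2 * atan (e^-1 * t))) => //.
- exact: poisson_ge0.
- exact: continuous_poisson.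
- by move=> t; rewrite /poisson sqrrN.
- exact: poisson_ge0.
- exact: continuous_poisson.
apply: cvgM; first exact: cvg_cst.
apply: (@cvg_comp _ _ _ (fun t => e^-1 * t) atan _ (pinfty_nbhs R)).
  by apply: gt0_cvgMry => //; rewrite invr_gt0.
exact: cvgy_atan.
Qed.

Lemma integral_poisson_itv (d : R) : 0 < d ->
  (\int[mu]_(t in `[(- d)%R, d]) (poisson t)%:E = (4 * atan (d / e))%:E)%E.
Proof.
move=> d0; rewrite (@continuous_FTC2 _ _ (fun t => 2 * atan (e^-1 * t))).
- by rewrite mulrN atanN -EFinB; congr _%:E; rewrite [d / e]mulrC; ring.
- by rewrite gtrN.
- by apply: continuous_subspaceT; exact: continuous_poisson.
- have C x : {for x, continuous (fun t => 2 * atan (e^-1 * t))}.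
    by apply: differentiable_continuous; exact/derivable1_diffP.
  by split => //; [apply: cvg_at_right_filter|apply: cvg_at_left_filter]; exact: C.
- by move=> t _; rewrite derive1E; exact: derive_val.
Qed.

End poisson.

(** * The Hartley transform of integrable functions *)

Section hartley_transform.
Context {R : realType}.
Notation mu := (leb R).
Implicit Types f g h : R -> R.

Definition cas (t : R) : R := cos t + sin t.

Lemma cas_bound t : `|cas t| <= 2.
Proof.
apply: le_trans (ler_normD _ _) _.
by rewrite -[2]/(1 + 1) lerD ?cos_max ?sin_max.
Qed.

(** The sum s + t occurs only in a sine: this is why the damped product of two
   kernels reduces to a convolution. *)
Lemma cas_mul s t : cas s * cas t = cos (s - t) + sin (s + t).
Proof. by rewrite /cas cosB sinD; ring. Qed.

Lemma measurable_cas : measurable_fun setT cas.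
Proof.
apply: continuous_measurable_fun => x; apply: cvgD.
  exact: continuous_cos.
exact: continuous_sin.
Qed.

Lemma measurable_cas2 : measurable_fun setT (fun z : R * R => cas (z.1 * z.2)).
Proof. by apply: (measurableT_comp measurable_cas); exact: measurable_funM. Qed.

Lemma measurable_cas_mul x : measurable_fun setT (fun y : R => cas (x * y)).
Proof. by apply: (measurableT_comp measurable_cas); exact: measurable_funM. Qed.

Definition normalization : R := (Num.sqrt (2 * pi))^-1.

Lemma normalization_gt0 : 0 < normalization.
Proof. by rewrite invr_gt0 sqrtr_gt0 mulr_gt0// pi_gt0. Qed.

Lemma normalization_sqr : normalization ^+ 2 = (2 * pi)^-1.
Proof. by rewrite exprVn sqr_sqrtr// mulr_ge0// pi_ge0. Qed.

Definition hker (z : R * R) : R := normalization * cas (z.1 * z.2).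

Lemma hker_bound z : `|hker z| <= normalization * 2.
Proof.
rewrite normrM gtr0_norm ?normalization_gt0// ler_pM2l ?normalization_gt0//.
exact: cas_bound.
Qed.

Lemma hkerC x y : hker (x, y) = hker (y, x).
Proof. by rewrite /hker/= mulrC [x * y]mulrC mulrC. Qed.

Lemma measurable_hker : measurable_fun setT hker.
Proof. by apply: measurable_funM => //; exact: measurable_cas2. Qed.

Lemma measurable_hker1 p : measurable_fun setT (fun x => hker (p, x)).
Proof. by apply: measurable_funM => //; exact: measurable_cas_mul. Qed.

(** The cosine and sine transforms added up: real-valued, with a symmetric
   kernel. *)
Definition hartley f (p : R) : R := \int[mu]_x (f x * hker (p, x)).

Notation integrable f := (mu.-integrable setT (EFin \o f)).

Lemma integrable_hker f p : integrable f -> integrable (fun x => f x * hker (p, x)).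
Proof.
move=> fi; apply: (integrable_mul_bounded fi (measurable_hker1 p)) => x.
exact: hker_bound.
Qed.

Lemma integrable_measurable f : integrable f -> measurable_fun setT f.
Proof. by move=> fi; apply/measurable_EFinP; case/integrableP : fi. Qed.

Lemma measurable_hartley f : measurable_fun setT f -> measurable_fun setT (hartley f).
Proof.
move=> mf; apply: (@measurable_Rintegral2 _ (fun z : R * R => f z.2 * hker z)).
apply: measurable_funM; last exact: measurable_hker.
exact: measurableT_comp.
Qed.

Lemma hartley_bound f : integrable f -> exists B, forall p, `|hartley f p| <= B.
Proof.
move=> fi; exists (\int[mu]_x (normalization * 2 * `|f x|)) => p.
have fci := integrable_hker p fi.
apply: le_trans (le_normr_Rintegral _ fci) _ => //.
have fni := integrable_norm fi.
apply: le_Rintegral => //.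
- exact: (integrable_norm fci).
- rewrite (_ : EFin \o _ = (fun x => (normalization * 2)%:E *
      (EFin \o (fun x : R => `|f x|)%R) x)%E).
    exact: integrableZl.
  by apply/funext => x; rewrite /= EFinM.
by move=> x _; rewrite normrM mulrC ler_wpM2r// hker_bound.
Qed.

Lemma hartleyB f g p : integrable f -> integrable g ->
  hartley (fun x => f x - g x) p = hartley f p - hartley g p.
Proof.
move=> fi gi; rewrite /hartley -RintegralB//; [|exact: integrable_hker..].
by apply: eq_Rintegral => x _; rewrite mulrBl.
Qed.

Lemma hartley_selfadjoint f g : integrable f -> integrable g ->
  inner (hartley f) g = inner f (hartley g).
Proof.
move=> fi gi; rewrite innerC /inner /hartley.
rewrite (fubini_bilinear gi fi measurable_hker hker_bound).
apply: eq_Rintegral => x _; congr (_ * _); apply: eq_Rintegral => y _.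
by rewrite hkerC.
Qed.

Lemma measurable_conv (K : R -> R) f : measurable_fun setT K -> measurable_fun setT f ->
  measurable_fun setT (fun x : R => \int[mu]_y (K (x - y) * f y)).
Proof.
move=> mK mf; apply: (@measurable_Rintegral2 _ (fun z : R * R => K (z.1 - z.2) * f z.2)).
by apply: measurable_funM; apply: measurableT_comp => //; exact: measurable_funB.
Qed.

(** Writing the square as a product and exchanging integrals twice leaves the
   integral over p of damp * cas (px) * cas (py), which is the Poisson kernel at
   x - y. *)
Lemma damped_hartley e f : 0 < e -> integrable f ->
  \int[mu]_p (damp e p * hartley f p ^+ 2) =
  (2 * pi)^-1 * \int[mu]_x (f x * \int[mu]_y (poisson e (x - y) * f y)).
Proof.
move=> e0 fi; have mf := integrable_measurable fi.
have [B hB] := hartley_bound fi.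
have di := integrable_damp e0.
have dhi := integrable_mul_bounded di (measurable_hartley mf) hB.
transitivity (\int[mu]_p (damp e p * hartley f p * \int[mu]_x (f x * hker (p, x)))).
  by apply: eq_Rintegral => p _; rewrite expr2 mulrA.
rewrite (fubini_bilinear dhi fi measurable_hker hker_bound).
have E (x : R) : \int[mu]_p (damp e p * hartley f p * hker (p, x)) =
    (2 * pi)^-1 * \int[mu]_y (poisson e (x - y) * f y).
  transitivity (\int[mu]_p ((damp e p * hker (x, p)) * \int[mu]_y (f y * hker (p, y)))).
    by apply: eq_Rintegral => p _; rewrite mulrAC hkerC.
  have dki := integrable_hker x di.
  rewrite (fubini_bilinear dki fi measurable_hker hker_bound).
  transitivity (\int[mu]_y (f y * ((2 * pi)^-1 * poisson e (x - y)))).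
    apply: eq_Rintegral => y _; congr (_ * _).
    rewrite -(integral_damp_cos_sin e0 (x - y) (x + y)) -RintegralZl//; last first.
      apply: (integrable_mul_bounded di (B := 2)).
        apply: measurable_funD; apply: continuous_measurable_fun.
          exact: cos_mul_continuous.
        exact: sin_mul_continuous.
      move=> p; apply: le_trans (ler_normD _ _) _.
      by rewrite -[2]/(1 + 1) lerD ?cos_max ?sin_max.
    apply: eq_Rintegral => p _.
    rewrite -normalization_sqr /hker/= mulrBl mulrDl.
    rewrite [y * p]mulrC -[cos _ + _](cas_mul (x * p) (p * y)); ring.
  transitivity (\int[mu]_y ((2 * pi)^-1 * (poisson e (x - y) * f y))).
    by apply: eq_Rintegral => y _; rewrite mulrCA [f y * _]mulrC.
  rewrite RintegralZl//.
  rewrite (_ : _ \o _ = EFin \o (fun y => f y * poisson e (x - y))); last first.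
    by apply/funext => y; rewrite /= mulrC.
  apply: (integrable_mul_bounded fi (B := 2 / e)).
    apply: measurableT_comp; first exact: measurable_poisson.
    exact: measurable_funB.
  move=> y; rewrite ger0_norm ?poisson_ge0//; exact: poisson_le.
have pi2 : 0 < 2 * pi :> R by rewrite mulr_gt0// pi_gt0.
have [B' hB'] := hartley_bound dhi.
rewrite -RintegralZl//.
  by apply: eq_Rintegral => x _; rewrite [RHS]mulrCA -E.
apply: (integrable_mul_bounded fi (B := 2 * pi * B')).
  by apply: measurable_conv => //; exact: measurable_poisson.
move=> x; have := hB' x.
rewrite (_ : hartley _ x = (2 * pi)^-1 * \int[mu]_y (poisson e (x - y) * f y)); last first.
  by rewrite -E; apply: eq_Rintegral => p _; rewrite hkerC.
rewrite normrM gtr0_norm ?invr_gt0//.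
by rewrite ler_pdivrMl.
Qed.

Lemma poisson_conv e f : 0 < e -> inL2 f ->
  inL2 (fun x => \int[mu]_y (poisson e (x - y) * f y)) /\
  normL2 (fun x => \int[mu]_y (poisson e (x - y) * f y)) <= 2 * pi * normL2 f.
Proof.
move=> e0 f2.
have P : (\int[mu]_t `|poisson e t|%:E = (2 * pi)%:E)%E.
  rewrite -(integral_poisson e0); apply: eq_integral => t _.
  by rewrite ger0_norm// poisson_ge0.
have Plt : (\int[mu]_t `|poisson e t|%:E < +oo)%E by rewrite P ltry.
have [c2 cn _] := young (measurable_poisson e0) Plt f2.
split => //; apply: le_trans cn _; rewrite ler_wpM2r ?normL2_ge0//.
by rewrite /Rintegral P.
Qed.

Lemma damp_half_sqr (e p : R) : damp (e / 2) p ^+ 2 = damp e p.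
Proof. by rewrite expr2 /damp -expRD; congr expR; field. Qed.

(** The right-hand side of damped_hartley is at most |f|^2 because the Poisson
   kernel has mass 2 pi. *)
Lemma damped_hartley_inL2 e f : 0 < e -> integrable f -> inL2 f ->
  inL2 (fun p => damp (e / 2) p * hartley f p) /\
  normL2 (fun p => damp (e / 2) p * hartley f p) <= normL2 f.
Proof.
move=> e0 fi f2; have mf := integrable_measurable fi.
have mh := measurable_hartley mf.
have [B hB] := hartley_bound fi.
apply: energy_le; first exact: normL2_ge0.
  by apply: measurable_funM => //; exact: measurable_damp.
have -> : energy (fun p => damp (e / 2) p * hartley f p) =
    (\int[mu]_p (damp e p * hartley f p ^+ 2))%:E.
  rewrite /Rintegral fineK.
    by apply: eq_integral => p _; rewrite exprMn damp_half_sqr.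
  apply: integrable_fin_num => //.
  apply: (integrable_mul_bounded (integrable_damp e0) (B := B ^+ 2)).
    exact: measurable_funX.
  move=> p; rewrite normrX ler_pXn2r ?nnegrE//.
  by apply: le_trans (hB 0).
have [c2 cn] := poisson_conv e0 f2.
rewrite damped_hartley// lee_fin ler_pdivrMl ?mulr_gt0 ?pi_gt0//.
apply: le_trans (ler_norm _) _; apply: le_trans (cauchy_schwarz f2 c2) _.
by rewrite expr2 mulrCA ler_wpM2l// normL2_ge0.
Qed.

(** The previous bound does not depend on e, which may tend to 0. *)
Lemma hartley_L1_contraction f : integrable f -> inL2 f ->
  inL2 (hartley f) /\ normL2 (hartley f) <= normL2 f.
Proof.
move=> fi f2; have mf := integrable_measurable fi.
pose e (n : nat) : R := n.+1%:R^-1.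
have e0 n : 0 < e n by rewrite invr_gt0.
apply: (normL2_fatou (u := fun n p => damp (e n / 2) p * hartley f p)).
- exact: normL2_ge0.
- by move=> n; have [] := damped_hartley_inL2 (e0 n) fi f2.
- exact: measurable_hartley.
- apply: aeW => p.
  have c1 : e n @[n --> \oo] --> (0 : R) by exact: cvg_harmonic.
  have c2 : - (e n / 2 * `|p|) @[n --> \oo] --> - (0 / 2 * `|p|).
    apply: cvgN; apply: cvgM; last exact: cvg_cst.
    by apply: cvgM => //; exact: cvg_cst.
  have c3 : damp (e n / 2) p @[n --> \oo] --> expR (- (0 / 2 * `|p|)).
    exact: (cvg_comp _ _ c2 (@continuous_expR R _)).
  have : damp (e n / 2) p * hartley f p @[n --> \oo] -->
      expR (- (0 / 2 * `|p|)) * hartley f p.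
    by apply: cvgM => //; exact: cvg_cst.
  by rewrite !mul0r oppr0 expR0 mul1r.
- by move=> n; have [] := damped_hartley_inL2 (e0 n) fi f2.
Qed.

End hartley_transform.

(** * Indicators of intervals *)

Section intervals.
Context {R : realType}.
Notation mu := (leb R).
Notation integrable f := (mu.-integrable setT (EFin \o f)).
Implicit Types (a b x : R).

Definition box a b : R -> R := \1_`[a, b]%classic.

Lemma boxE a b x : box a b x = ((a <= x) && (x <= b))%:R.
Proof. by rewrite /box indicE mem_setE in_itv. Qed.

Lemma box_ge0 a b x : 0 <= box a b x.
Proof. by rewrite boxE. Qed.

Lemma measurable_box a b : measurable_fun setT (box a b).
Proof. exact: measurable_indic. Qed.

Lemma integral_box a b : a <= b -> (\int[mu]_x (box a b x)%:E = (b - a)%:E)%E.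
Proof.
move=> ab; rewrite integral_indic// setIT/=.
rewrite (lebesgue_measure_itv `[a, b])/= lte_fin.
case: ltP => // ba; have -> : b = a by apply/le_anti; rewrite ab ba.
by rewrite subrr.
Qed.

Lemma integrable_box a b : integrable (box a b).
Proof.
have [ab|ba] := leP a b; last first.
  rewrite (_ : _ \o _ = cst 0%E); first exact: integrable0.
  apply/funext => x /=; rewrite boxE; case: (leP a x) => //= ax.
  by rewrite leNgt (lt_le_trans ba ax).
apply/integrableP; split; first by apply/measurable_EFinP; exact: measurable_box.
rewrite (_ : \int[mu]_x _ = (b - a)%:E)%E ?ltry// -(integral_box ab).
by apply: eq_integral => x _; rewrite /= ger0_norm// box_ge0.
Qed.

Lemma box_sqr a b x : box a b x ^+ 2 = box a b x.
Proof. by rewrite boxE; case: (_ && _); rewrite ?expr1n ?expr0n. Qed.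

Lemma energy_box a b : a <= b -> energy (box a b) = (b - a)%:E.
Proof.
move=> ab; rewrite -integral_box//.
by apply: eq_integral => x _; rewrite box_sqr.
Qed.

Lemma inL2_box a b : inL2 (box a b).
Proof.
apply/inL2P; split; first exact: measurable_box.
have /integrableP[_] := integrable_box a b; apply: le_lt_trans.
apply: ge0_le_integralT.
- by move=> x; rewrite lee_fin sqr_ge0.
- by apply/measurable_EFinP/measurable_funX; exact: measurable_box.
- by apply: measurableT_comp => //; apply/measurable_EFinP; exact: measurable_box.
by move=> x; rewrite box_sqr /= lee_fin ler_norm.
Qed.

Lemma normL2_box_sqr a b : a <= b -> normL2 (box a b) ^+ 2 = b - a.
Proof.
by move=> ab; apply: EFin_inj; rewrite normL2_sqr ?energy_box//; exact: inL2_box.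
Qed.

Lemma Rintegral_box (f : R -> R) a b :
  \int[mu]_x (f x * box a b x) = \int[mu]_(x in `[a, b]) f x.
Proof.
rewrite [RHS]Rintegral_mkcond; apply: eq_Rintegral => x _.
by rewrite patchE /box indicE; case: ifPn; rewrite ?mulr1 ?mulr0.
Qed.

(** The interval contains [x - d, x + d], over which the kernel centred at x has
   mass 4 atan (d / e), close to 2 pi when e is small compared with d. *)
Lemma poisson_conv_box_ge e a b d x : 0 < e -> 0 < d -> a + d <= x -> x <= b - d ->
  4 * atan (d / e) <= \int[mu]_y (poisson e (x - y) * box a b y).
Proof.
move=> e0 d0 ax xb.
have mp : measurable_fun setT (fun y : R => poisson e (x - y)).
  apply: (measurableT_comp (measurable_poisson e0)); exact: measurable_funB.
have -> : 4 * atan (d / e) = \int[mu]_t (poisson e t * box (- d) d t).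
  by rewrite Rintegral_box /Rintegral integral_poisson_itv.
rewrite -(Rintegral_reflect x); last first.
  by apply: measurable_funM; [exact: measurable_poisson|exact: measurable_box].
apply: le_Rintegral => //.
- have -> : EFin \o (fun y => poisson e (x - y) * box (- d) d (x - y)) =
      EFin \o (fun y => box (x - d) (x + d) y * poisson e (x - y)).
    apply/funext => y /=; rewrite mulrC !boxE; congr ((nat_of_bool _)%:R * _)%:E.
    by apply/idP/idP => /andP[? ?]; apply/andP; split; lra.
  apply: (integrable_mul_bounded (B := 2 / e) (integrable_box _ _) mp) => y.
  by rewrite ger0_norm ?poisson_ge0 ?poisson_le.
- have -> : EFin \o (fun y => poisson e (x - y) * box a b y) =
      EFin \o (fun y => box a b y * poisson e (x - y)).
    by apply/funext => y /=; rewrite mulrC.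
  apply: (integrable_mul_bounded (B := 2 / e) (integrable_box _ _) mp) => y.
  by rewrite ger0_norm ?poisson_ge0 ?poisson_le.
move=> y _; rewrite ler_wpM2l ?poisson_ge0// !boxE.
case: (boolP ((- d <= _) && _)) => [/andP[y1 y2]|_]; last by rewrite ler0n.
by rewrite (_ : (a <= y) && (y <= b))//; apply/andP; split; lra.
Qed.

(** The damping factor is at most 1, and in damped_hartley only the points at
   distance at least d from the ends of the interval are kept. *)
Lemma hartley_box_ge a b e d : 0 < e -> 0 < d -> d <= (b - a) / 2 ->
  (b - a - 2 * d) * (4 * atan (d / e)) / (2 * pi) <= normL2 (hartley (box a b)) ^+ 2.
Proof.
move=> e0 d0 dab; have ib := integrable_box a b; have b2 := inL2_box a b.
have [h2 _] := hartley_L1_contraction ib b2.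
have [B hB] := hartley_bound ib.
have mh := inL2_measurable h2.
have h2i : integrable (fun p => hartley (box a b) p ^+ 2).
  by have := inner_integrable h2 h2; under eq_fun do rewrite -expr2.
have -> : normL2 (hartley (box a b)) ^+ 2 = \int[mu]_p (hartley (box a b) p ^+ 2).
  by rewrite -inner_sqr//; apply: eq_Rintegral => p _; rewrite expr2.
apply: (@le_trans _ _ (\int[mu]_p (damp e p * hartley (box a b) p ^+ 2))); last first.
  have E : (fun p => damp e p * hartley (box a b) p ^+ 2) =
      (fun p => hartley (box a b) p ^+ 2 * damp e p).
    by apply/funext => p; rewrite mulrC.
  rewrite E; apply: le_Rintegral => //.
    apply: (integrable_mul_bounded h2i (measurable_damp e) (B := 1)) => p.
    by rewrite ger0_norm ?damp_ge0 ?damp_le1.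
  by move=> p _; rewrite ler_piMr ?sqr_ge0// damp_le1.
rewrite damped_hartley// mulrC ler_wpM2l ?invr_ge0 ?mulr_ge0 ?pi_ge0//.
have [T2 _] := poisson_conv e0 b2.
pose k := 4 * atan (d / e).
have k0 : 0 <= k.
  by rewrite mulr_ge0// -atan0 le_atan// divr_ge0// ltW.
apply: (@le_trans _ _ (\int[mu]_x (box (a + d) (b - d) x * k))).
  rewrite RintegralZr//; last exact: integrable_box.
  rewrite /Rintegral integral_box/=; last by lra.
  by rewrite le_eqVlt; apply/orP; left; apply/eqP; rewrite /k; ring.
apply: le_Rintegral => //.
- by apply: (integrable_mul_bounded (integrable_box _ _) (B := `|k|)).
- exact: inner_integrable.
move=> x _; rewrite !boxE.
have T0 : 0 <= \int[mu]_y (poisson e (x - y) * box a b y).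
  by apply: Rintegral_ge0 => y _; rewrite mulr_ge0 ?box_ge0 ?poisson_ge0.
case: (boolP ((a + d <= x) && _)) => [/andP[x1 x2]|_]; last first.
  by rewrite mul0r mulr_ge0.
rewrite (_ : (a <= x) && (x <= b)); last by apply/andP; split; lra.
by rewrite !mul1r; exact: poisson_conv_box_ge.
Qed.

(** Together with the contraction property, H preserves the norm of the indicator
   of an interval. *)
Lemma normL2_box_le_hartley a b : a < b ->
  normL2 (box a b) <= normL2 (hartley (box a b)).
Proof.
move=> ab; rewrite -(@ler_pXn2r _ 2)// ?nnegrE ?normL2_ge0//.
rewrite normL2_box_sqr ?(ltW ab)//.
pose h (n : nat) : R := n.+1%:R^-1.
have h0 n : 0 < h n by rewrite invr_gt0.
have hn1 n : h n <= 1 by rewrite invf_le1// ler1n.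
(* d and e = d * h tend to 0 with d / e = n.+1 tending to infinity *)
pose d n := (b - a) / 2 * h n.
have ba0 : 0 < b - a by rewrite subr_gt0.
have d0 n : 0 < d n by rewrite mulr_gt0// divr_gt0.
pose u n := (b - a - 2 * d n) * (4 * atan (n.+1%:R)) / (2 * pi).
have uN n : u n <= normL2 (hartley (box a b)) ^+ 2.
  have := @hartley_box_ge a b (d n * h n) (d n) _ (d0 n) _.
  have -> : d n / (d n * h n) = n.+1%:R.
    by rewrite invfM mulrA divff ?mul1r ?invrK// gt_eqF.
  apply.
    by rewrite mulr_gt0.
  by rewrite ler_piMr// divr_ge0// ltW.
have hcvg : h n @[n --> \oo] --> (0 : R) by exact: cvg_harmonic.
have ucvg : u n @[n --> \oo] -->
    (b - a - 2 * ((b - a) / 2 * 0)) * (4 * (pi / 2)) / (2 * pi).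
  apply: cvgM; last exact: cvg_cst.
  apply: cvgM.
    apply: cvgB; first exact: cvg_cst.
    apply: cvgM; first exact: cvg_cst.
    by apply: cvgM => //; exact: cvg_cst.
  apply: cvgM; first exact: cvg_cst.
  have := @cvgr_idn R; rewrite -cvg_shiftS => nR.
  exact: (cvg_comp _ _ nR (@cvgy_atan R)).
have E : (b - a - 2 * ((b - a) / 2 * 0)) * (4 * (pi / 2)) / (2 * pi) = b - a.
  have : (pi : R) != 0 by rewrite gt_eqF ?pi_gt0.
  by move: (pi : R) => q q0; field.
rewrite E in ucvg.
have : limn u <= normL2 (hartley (box a b)) ^+ 2.
  by apply: limr_le; [exact: (cvgP _ ucvg)|exact: nearW].
by rewrite (cvg_lim _ ucvg).
Qed.

End intervals.

(** * Truncations *)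

Section truncation.
Context {R : realType}.
Notation mu := (leb R).
Notation integrable f := (mu.-integrable setT (EFin \o f)).
Implicit Types f g h : R -> R.

Definition trunc (n : nat) f : R -> R := fun x => f x * box (- n%:R) n%:R x.

Lemma trunc_dominated n f x : `|trunc n f x| <= 1 * `|f x|.
Proof.
by rewrite mul1r normrM ler_piMr// boxE; case: ((_ <= x) && _); rewrite ?normr1 ?normr0 ?ler01.
Qed.

Lemma inL2_trunc n f : inL2 f -> inL2 (trunc n f).
Proof.
move=> f2; apply: (inL2_dominated _ _ f2 (trunc_dominated n f)).1 => //.
by apply: measurable_funM; [exact: inL2_measurable|exact: measurable_box].
Qed.

Lemma normL2_trunc n f : inL2 f -> normL2 (trunc n f) <= normL2 f.
Proof.
move=> f2; rewrite -[leRHS]mul1r.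
apply: (inL2_dominated _ _ f2 (trunc_dominated n f)).2 => //.
by apply: measurable_funM; [exact: inL2_measurable|exact: measurable_box].
Qed.

Lemma integrable_trunc n f : inL2 f -> integrable (trunc n f).
Proof. by move=> f2; apply: inner_integrable => //; exact: inL2_box. Qed.

Lemma normL2_cvg0 (u : nat -> R -> R) : (forall n, inL2 (u n)) ->
  (energy (u n) @[n --> \oo] --> 0)%E -> normL2 (u n) @[n --> \oo] --> 0.
Proof.
move=> u2 eu.
have : Num.sqrt (fine (energy (u n))) @[n --> \oo] --> Num.sqrt (0 : R).
  by apply: continuous_cvg; [exact: sqrt_continuous|exact: fine_cvg].
rewrite sqrtr0; under eq_fun do rewrite -normL2_sqr// sqrtr_sqr ger0_norm ?normL2_ge0//.
by [].
Qed.

Lemma trunc_cvg f : inL2 f ->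
  normL2 (fun x => trunc n f x - f x) @[n --> \oo] --> 0.
Proof.
move=> f2; have mf := inL2_measurable f2.
have t2 n : inL2 (fun x => trunc n f x - f x) by apply: inL2B => //; exact: inL2_trunc.
apply: normL2_cvg0 => //.
pose s n (x : R) := ((trunc n f x - f x) ^+ 2)%:E.
have ms n : measurable_fun setT (s n).
  by apply/measurable_EFinP/measurable_funX; exact: inL2_measurable.
have s0 : {ae mu, forall x, setT x -> s n x @[n --> \oo] --> cst 0%E x}.
  apply: aeW => x _; apply: cvg_near_cst.
  have [N Nx] : exists N, `|x| <= N%:R by exists (Num.bound `|x|); exact/ltW/archi_boundP.
  exists N => // n /= Nn; rewrite /s /trunc boxE -ler_norml.
  rewrite (le_trans Nx) ?ler_nat//.
  by rewrite mulr1 subrr expr0n.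
have sf : {ae mu, forall x n, setT x -> (`|s n x| <= (f x ^+ 2)%:E)%E}.
  apply: aeW => x n _; rewrite /= lee_fin normrX -[leRHS]real_normK ?num_real//.
  rewrite ler_pXn2r ?nnegrE// /trunc boxE.
  by case: ((_ <= x) && _); rewrite ?mulr1 ?mulr0 ?subrr ?normr0// sub0r normrN.
have [_ _] := @dominated_convergence _ _ R mu setT measurableT s (cst 0%E)
  (fun x => (f x ^+ 2)%:E) ms (measurable_cst _) s0
  (Lfun2_integrable_sqr f2) sf.
by rewrite integral0.
Qed.

Lemma inner_cvg (u v : nat -> R -> R) f g :
  (forall n, inL2 (u n)) -> (forall n, inL2 (v n)) -> inL2 f -> inL2 g ->
  normL2 (fun x => u n x - f x) @[n --> \oo] --> 0 ->
  normL2 (fun x => v n x - g x) @[n --> \oo] --> 0 ->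
  inner (u n) (v n) @[n --> \oo] --> inner f g.
Proof.
move=> u2 v2 f2 g2 uf vg.
pose eu n := normL2 (fun x => u n x - f x); pose ev n := normL2 (fun x => v n x - g x).
apply/subr_cvg0; apply: norm_cvg0.
apply: (@squeeze_cvgr _ _ _ _ (fun=> 0)
  (fun n => eu n * (normL2 g + ev n) + normL2 f * ev n)).
- apply: nearW => n; rewrite normr_ge0/=.
  have -> : inner (u n) (v n) - inner f g =
      inner (fun x => u n x - f x) (v n) + inner f (fun x => v n x - g x).
    by rewrite innerBl// innerBr//; ring.
  apply: le_trans (ler_normD _ _) _; rewrite lerD//.
    apply: le_trans (cauchy_schwarz (inL2B (u2 n) f2) (v2 n)) _.
    by rewrite ler_wpM2l ?normL2_ge0//; exact: normL2_le_add.
  exact: (cauchy_schwarz f2 (inL2B (v2 n) g2)).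
- exact: cvg_cst.
have -> : (0 : R) = 0 * (normL2 g + 0) + normL2 f * 0 by ring.
apply: cvgD; last by apply: cvgM => //; exact: cvg_cst.
by apply: cvgM => //; apply: cvgD => //; exact: cvg_cst.
Qed.

Lemma normL2_cvg (u : nat -> R -> R) f : (forall n, inL2 (u n)) -> inL2 f ->
  normL2 (fun x => u n x - f x) @[n --> \oo] --> 0 ->
  normL2 (u n) @[n --> \oo] --> normL2 f.
Proof.
move=> u2 f2 uf; apply/subr_cvg0; apply: norm_cvg0.
apply: (@squeeze_cvgr _ _ _ _ (fun=> 0) (fun n => normL2 (fun x => u n x - f x))) => //.
  apply: nearW => n; rewrite normr_ge0/= ler_norml.
  have := normL2_le_add (u2 n) f2; have := normL2_le_add f2 (u2 n).
  by rewrite normL2BC => ? ?; apply/andP; split; lra.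
exact: cvg_cst.
Qed.

End truncation.

(** * Plancherel's theorem for the Hartley transform *)

Section hartley_L2.
Context {R : realType}.
Notation mu := (leb R).
Notation integrable f := (mu.-integrable setT (EFin \o f)).
Implicit Types f g h w z : R -> R.

(** The truncations are integrable, so that their transforms are given by the
   integral; this mirrors the definition of the Fourier-Plancherel transform. *)
Definition is_hartley f w : Prop :=
  [/\ inL2 f, inL2 w &
    normL2 (fun p => hartley (trunc n f) p - w p) @[n --> \oo] --> 0].

Lemma inL2_hartley_trunc n f : inL2 f -> inL2 (hartley (trunc n f)).
Proof.
by move=> f2; have [] := hartley_L1_contraction (integrable_trunc n f2) (inL2_trunc n f2).
Qed.

Lemma normL2_hartley_truncB m f n g : inL2 f -> inL2 g ->
  normL2 (fun p => hartley (trunc m f) p - hartley (trunc n g) p) <=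
  normL2 (fun x => trunc m f x - trunc n g x).
Proof.
move=> f2 g2; have fi := integrable_trunc m f2; have gi := integrable_trunc n g2.
have -> : (fun p => hartley (trunc m f) p - hartley (trunc n g) p) =
    hartley (fun x => trunc m f x - trunc n g x).
  by apply/funext => p; rewrite hartleyB.
apply: (hartley_L1_contraction _ _).2.
  rewrite (_ : _ \o _ = ((EFin \o trunc m f) \- (EFin \o trunc n g))%E)//.
  exact: integrableB.
by apply: inL2B; exact: inL2_trunc.
Qed.

Lemma is_hartley_ex f : inL2 f -> exists w, is_hartley f w.
Proof.
move=> f2; have [|e e0|w w2 hw] := @L2_complete R (fun n => hartley (trunc n f)).
- by move=> n; exact: inL2_hartley_trunc.
- have /cvgrPdist_le/(_ (e / 2)) := trunc_cvg f2.
  rewrite divr_gt0// => /(_ isT)[N _ NP]; exists N => m n Nm Nn.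
  have [/NP + /NP] := (Nm, Nn); rewrite !sub0r !normrN !ger0_norm ?normL2_ge0// => em en.
  apply: le_trans (normL2_hartley_truncB m n f2 f2) _.
  apply: le_trans (normL2_trianglel (inL2_trunc m f2) f2 (inL2_trunc n f2)) _.
  by rewrite [X in _ + X]normL2BC [leRHS]splitr lerD.
by exists w; split.
Qed.

Lemma is_hartley_contraction f w : is_hartley f w -> normL2 w <= normL2 f.
Proof.
move=> [f2 w2 fw]; have h2 n := inL2_hartley_trunc n f2.
have nw := normL2_cvg h2 w2 fw.
rewrite -(cvg_lim _ nw)//; apply: limr_le; first exact: (cvgP _ nw).
apply: nearW => n; apply: le_trans (normL2_trunc n f2).
exact: (hartley_L1_contraction (integrable_trunc n f2) (inL2_trunc n f2)).2.
Qed.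

Lemma is_hartleyB f w g z : is_hartley f w -> is_hartley g z ->
  is_hartley (fun x => f x - g x) (fun p => w p - z p).
Proof.
move=> [f2 w2 fw] [g2 z2 gz]; split; [exact: inL2B..|].
have hf n := inL2_hartley_trunc n f2; have hg n := inL2_hartley_trunc n g2.
have -> : (fun n => normL2 (fun p => hartley (trunc n (fun x => f x - g x)) p - (w p - z p))) =
   (fun n => normL2 (fun p => (hartley (trunc n f) p - w p) - (hartley (trunc n g) p - z p))).
  apply/funext => n; apply: eq_normL2 => p.
  rewrite (_ : trunc n (fun x => f x - g x) = (fun x => trunc n f x - trunc n g x)).
    by rewrite hartleyB; [ring|exact: integrable_trunc..].
  by apply/funext => x; rewrite /trunc mulrBl.
apply: (@squeeze_cvgr _ _ _ _ (fun=> 0) (fun n =>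
  normL2 (fun p => hartley (trunc n f) p - w p) +
  normL2 (fun p => hartley (trunc n g) p - z p))).
- by apply: nearW => n; rewrite normL2_ge0/= normL2B//; exact: inL2B.
- exact: cvg_cst.
by rewrite -(addr0 0); exact: cvgD.
Qed.

Lemma is_hartley_unique f w z : is_hartley f w -> is_hartley f z -> w = z %[ae mu].
Proof.
move=> fw fz; have d := is_hartleyB fw fz.
have [_ d2 _] := d; have := is_hartley_contraction d.
rewrite (_ : (fun x => f x - f x) = (fun=> 0)); last by apply/funext => x; rewrite subrr.
rewrite normL2_0 => d0; have : normL2 (fun p => w p - z p) = 0.
  by apply/le_anti; rewrite d0 normL2_ge0.
move=> /(normL2_eq0 d2); apply: filterS => x /= /[apply] /eqP.
by rewrite subr_eq0 => /eqP.
Qed.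

Lemma is_hartley_ae f f' w w' : is_hartley f w -> f = f' %[ae mu] -> w = w' %[ae mu] ->
  measurable_fun setT f' -> measurable_fun setT w' -> is_hartley f' w'.
Proof.
move=> [f2 w2 fw] ff ww mf mw; split; [exact: inL2_ae ff mf f2|exact: inL2_ae ww mw w2|].
have h2 n := inL2_hartley_trunc n f2.
rewrite (_ : (fun n => _) = (fun n => normL2 (fun p => hartley (trunc n f) p - w p)))//.
apply/funext => n; rewrite (_ : hartley (trunc n f') = hartley (trunc n f)).
  apply: normL2_ae; last 2 first.
  - by apply: measurable_funB => //; exact: inL2_measurable.
  - by apply: measurable_funB; exact: inL2_measurable.
  by apply: filterS ww => p /= /[apply] ->.
apply/funext => p; congr fine; apply: ae_eq_integral => //.
- apply/measurable_EFinP; apply: measurable_funM; last exact: measurable_hker1.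
  by apply: measurable_funM => //; exact: measurable_box.
- apply/measurable_EFinP; apply: measurable_funM; last exact: measurable_hker1.
  by apply: inL2_measurable; exact: inL2_trunc.
by apply: filterS ff => x /= /[apply] ffx; rewrite /trunc ffx.
Qed.

(** Symmetry of the kernel, extended to L2 by continuity of the inner product. *)
Lemma is_hartley_selfadjoint f w g z : is_hartley f w -> is_hartley g z ->
  inner w g = inner f z.
Proof.
move=> [f2 w2 fw] [g2 z2 gz].
have hf n := inL2_hartley_trunc n f2; have hg n := inL2_hartley_trunc n g2.
have tf n := inL2_trunc n f2; have tg n := inL2_trunc n g2.
have l1 := inner_cvg hf tg w2 g2 fw (trunc_cvg g2).
have l2 := inner_cvg tf hg f2 z2 (trunc_cvg f2) gz.
have E : (fun n => inner (hartley (trunc n f)) (trunc n g)) =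
    (fun n => inner (trunc n f) (hartley (trunc n g))).
  by apply/funext => n; apply: hartley_selfadjoint; exact: integrable_trunc.
rewrite E in l1.
by rewrite -(cvg_lim _ l1)//; exact: cvg_lim.
Qed.

Lemma is_hartley_integrable f : integrable f -> inL2 f -> is_hartley f (hartley f).
Proof.
move=> fi f2; have [h2 _] := hartley_L1_contraction fi f2; split => //.
apply: (@squeeze_cvgr _ _ _ _ (fun=> 0) (fun n => normL2 (fun x => trunc n f x - f x))).
- apply: nearW => n; rewrite normL2_ge0/=.
  have ti := integrable_trunc n f2.
  rewrite (_ : (fun p => _) = hartley (fun x => trunc n f x - f x)); last first.
    by apply/funext => p; rewrite hartleyB.
  apply: (hartley_L1_contraction _ _).2.
    rewrite (_ : _ \o _ = ((EFin \o trunc n f) \- (EFin \o f))%E)//.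
    exact: integrableB.
  by apply: inL2B => //; exact: inL2_trunc.
- exact: cvg_cst.
exact: trunc_cvg.
Qed.

(** A self-adjoint contraction which preserves the norm of x satisfies
   |HHx - x|^2 = |HHx|^2 - 2 |Hx|^2 + |x|^2 <= 0. *)
Lemma is_hartley_box_invol a b w z : a < b ->
  is_hartley (box a b) w -> is_hartley w z -> z = box a b %[ae mu].
Proof.
move=> ab bw wz; have b2 := inL2_box a b.
have [_ w2 _] := bw; have [_ z2 _] := wz.
have bh := is_hartley_integrable (integrable_box a b) b2.
have nw : normL2 w = normL2 (box a b).
  apply/le_anti; rewrite is_hartley_contraction//=.
  rewrite (normL2_ae (is_hartley_unique bw bh)); last 2 first.
  - exact: inL2_measurable.
  - by have [_ /inL2_measurable] := bh.
  exact: normL2_box_le_hartley.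
have d2 := inL2B z2 b2.
suff : normL2 (fun x => z x - box a b x) = 0.
  move=> /(normL2_eq0 d2); apply: filterS => x /= /[apply] /eqP.
  by rewrite subr_eq0 => /eqP.
apply/eqP; rewrite -sqrf_eq0 eq_le sqr_ge0 andbT -inner_sqr//.
rewrite innerBl// !innerBr// !inner_sqr//.
rewrite [inner (box a b) z]innerC (is_hartley_selfadjoint wz bw) inner_sqr// nw.
have := is_hartley_contraction wz; rewrite nw -(@ler_pXn2r _ 2)// ?nnegrE ?normL2_ge0//.
lra.
Qed.

(** By the fundamental theorem of calculus a locally integrable function is
   almost everywhere the derivative of its indefinite integral, which is 0 here;
   truncation provides integrability on the whole line. *)
Lemma inL2_eq0_box f : inL2 f -> (forall a b, a < b -> inner f (box a b) = 0) ->
  f = (fun=> 0) %[ae mu].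
Proof.
move=> f2 fb.
have tn n : trunc n f = (fun=> 0) %[ae mu].
  have ti := integrable_trunc n f2.
  have lt : locally_integrable setT (trunc n f).
    by have := integrable_locally measurableT ti; rewrite patch_setT.
  have tiy y : mu.-integrable `]-oo, y] (EFin \o trunc n f).
    exact: integrableS ti.
  have F0 : (fun x => \int[mu]_(t in `]-oo, x]) trunc n f t) = cst 0.
    apply/funext => x; rewrite Rintegral_mkcond.
    pose m := Num.min x n%:R.
    transitivity (inner f (box (- n%:R) m)).
      apply: eq_Rintegral => t _; rewrite patchE mem_setE in_itv/= /trunc !boxE /m le_min.
      by case: (_ <= x); rewrite /= ?andbT ?andbF ?mulr0.
    have [nm|mn] := ltP (- n%:R) m; first exact: fb.
    rewrite /inner Rintegral_box; move: mn; rewrite le_eqVlt => /predU1P[->|mn].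
      by rewrite set_itv1 Rintegral_set1.
    by rewrite set_itv_ge ?Rintegral_set0// bnd_simp -ltNge.
  have := FTC1Ny tiy lt; rewrite /= F0; apply: filterS => x [_ <-] _.
  by rewrite derive1_cst.
have : {ae mu, forall x, forall n, trunc n f x = 0}.
  by apply/ae_foralln => n; apply: filterS (tn n) => x /(_ I).
apply: filterS => x tx _.
have [N Nx] : exists N, `|x| <= N%:R by exists (Num.bound `|x|); exact/ltW/archi_boundP.
by rewrite -(tx N) /trunc boxE -ler_norml Nx mulr1.
Qed.

(** By self-adjointness HHf - f has the same inner product with the indicator x of
   an interval as f has with HHx - x, which is 0. *)
Lemma is_hartley_sym f w : is_hartley f w -> is_hartley w f.
Proof.
move=> fw; have [f2 w2 _] := fw; have [z wz] := is_hartley_ex w2.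
have [_ z2 _] := wz.
suff zf : z = f %[ae mu].
  apply: (is_hartley_ae wz) => //; [exact: aeW|exact: inL2_measurable..].
have d2 := inL2B z2 f2.
suff : (fun x => z x - f x) = (fun=> 0) %[ae mu].
  by apply: filterS => x /= /[apply] /eqP; rewrite subr_eq0 => /eqP.
apply: inL2_eq0_box => // a b ab; have b2 := inL2_box a b.
have [bw hb] := is_hartley_ex b2; have [_ bw2 _] := hb.
have [bz hz] := is_hartley_ex bw2; have [_ bz2 _] := hz.
have bE := is_hartley_box_invol ab hb hz.
rewrite innerBl// (is_hartley_selfadjoint wz hb) (is_hartley_selfadjoint fw hz).
apply/eqP; rewrite subr_eq0; apply/eqP; congr fine.
apply: ae_eq_integral => //.
- by apply/measurable_EFinP; apply: measurable_funM; exact: inL2_measurable.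
- by apply/measurable_EFinP; apply: measurable_funM; exact: inL2_measurable.
by apply: filterS bE => x /= /[apply] ->.
Qed.

(** Both H and its inverse, which is H, are contractions. *)
Lemma is_hartley_isometry f w : is_hartley f w -> normL2 w = normL2 f.
Proof.
move=> fw; apply/le_anti; rewrite is_hartley_contraction//=.
by apply: is_hartley_contraction; exact: is_hartley_sym.
Qed.

End hartley_L2.

(** * From the Hartley transform to the Fourier transform *)

Section fourier_of_hartley.
Local Open Scope complex_scope.
Context {R : realType}.
Notation mu := (leb R).
Notation integrable f := (mu.-integrable setT (EFin \o f)).
Implicit Types f g h w z : R -> R.
Implicit Types F G : R -> R[i].
Notation normc := Normc.normc.

Definition even_part w (p : R) : R := (w p + w (- p)) / 2.
Definition odd_part w (p : R) : R := (w p - w (- p)) / 2.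

(** The Fourier transform of a function with Hartley transform w: the even part
   of w is its cosine transform, the odd part its sine transform. *)
Definition fourier_of w (p : R) : R[i] := even_part w p -i* odd_part w p.

Lemma normc_sqr (x y : R) : normc (x +i* y) ^+ 2 = x ^+ 2 + y ^+ 2.
Proof. by rewrite /= sqr_sqrtr// addr_ge0// sqr_ge0. Qed.

Lemma normc_ge0 (x : R[i]) : 0 <= normc x.
Proof. by case: x => x y /=; exact: sqrtr_ge0. Qed.

Lemma normc_fourier_of_sqr w p :
  normc (fourier_of w p) ^+ 2 = 2^-1 * (w p ^+ 2 + w (- p) ^+ 2).
Proof. by rewrite normc_sqr /even_part /odd_part; field. Qed.

Lemma fourier_ofB w z p :
  fourier_of w p - fourier_of z p = fourier_of (fun p => w p - z p) p.
Proof.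
rewrite /fourier_of /even_part /odd_part; simpc.
by congr (_ +i* _); field.
Qed.

Definition measurable_complex F :=
  measurable_fun setT (fun p => complex.Re (F p)) /\
  measurable_fun setT (fun p => complex.Im (F p)).

Lemma measurable_normc F : measurable_complex F -> measurable_fun setT (fun p => normc (F p)).
Proof.
move=> [mr mi].
have msqrt : measurable_fun setT (@Num.sqrt R).
  by apply: continuous_measurable_fun; exact: sqrt_continuous.
rewrite (_ : (fun p => _) =
  (fun p => Num.sqrt (complex.Re (F p) ^+ 2 + complex.Im (F p) ^+ 2))); last first.
  by apply/funext => p; case: (F p).
by apply: (measurableT_comp msqrt); apply: measurable_funD; exact: measurable_funX.
Qed.

Lemma measurable_complexB F G : measurable_complex F -> measurable_complex G ->
  measurable_complex (fun p => F p - G p).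
Proof.
move=> [Fr Fi] [Gr Gi]; split.
  rewrite (_ : (fun p => _) = (fun p => complex.Re (F p) - complex.Re (G p))).
    exact: measurable_funB.
  by apply/funext => p; case: (F p) => ? ?; case: (G p).
rewrite (_ : (fun p => _) = (fun p => complex.Im (F p) - complex.Im (G p))).
  exact: measurable_funB.
by apply/funext => p; case: (F p) => ? ?; case: (G p).
Qed.

Lemma measurable_opp_arg w : measurable_fun setT w -> measurable_fun setT (fun p : R => w (- p)).
Proof. by move=> mw; apply: measurableT_comp. Qed.

Lemma measurable_fourier_of w : measurable_fun setT w -> measurable_complex (fourier_of w).
Proof.
move=> mw; have mwN := measurable_opp_arg mw; split => /=.
  by apply: measurable_funM => //; exact: measurable_funD.
apply: measurableT_comp => //.
by apply: measurable_funM => //; exact: measurable_funB.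
Qed.

Lemma energy_opp w : measurable_fun setT w -> energy (fun p : R => w (- p)) = energy w.
Proof.
move=> mw; rewrite -[RHS](integral_reflect 0); last 2 first.
- by apply/measurable_EFinP/measurable_funX.
- by move=> x; rewrite lee_fin sqr_ge0.
by apply: eq_integral => x _; rewrite sub0r.
Qed.

Lemma inL2_opp w : inL2 w -> inL2 (fun p : R => w (- p)).
Proof.
by move=> /inL2P[mw ew]; apply/inL2P; rewrite energy_opp//; split => //; exact: measurable_opp_arg.
Qed.

(** Since normc (fourier_of w p)^2 is the mean of w(p)^2 and w(-p)^2. *)
Lemma energy_fourier_of w : measurable_fun setT w ->
  energy (fun p => normc (fourier_of w p)) = energy w.
Proof.
move=> mw; have mwN := measurable_opp_arg mw.
rewrite /energy; under eq_integral do rewrite normc_fourier_of_sqr EFinM EFinD.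
rewrite ge0_integralZl//; last 2 first.
- by apply: emeasurable_funD; apply/measurable_EFinP/measurable_funX.
- by move=> x _; rewrite -EFinD lee_fin addr_ge0// sqr_ge0.
rewrite ge0_integralD//; last 4 first.
- by move=> x _; rewrite lee_fin sqr_ge0.
- by apply/measurable_EFinP/measurable_funX.
- by move=> x _; rewrite lee_fin sqr_ge0.
- by apply/measurable_EFinP/measurable_funX.
rewrite -/(energy w) -/(energy (fun p : R => w (- p))) energy_opp//.
have : (0 <= energy w)%E by exact: energy_ge0.
case: (energy w) => [r _| _|//]; last first.
  by rewrite addye// gt0_muley// lte_fin invr_gt0.
by rewrite -EFinD -EFinM; congr _%:E; field.
Qed.

Lemma fourier_of_inL2 w : inL2 w ->
  inL2 (fun p => complex.Re (fourier_of w p)) /\ inL2 (fun p => complex.Im (fourier_of w p)).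
Proof.
move=> w2; have wN2 := inL2_opp w2; split => /=.
  rewrite (_ : (fun p => _) = (fun p => 2^-1 * (w p + w (- p)))); last first.
    by apply/funext => p; rewrite mulrC.
  by apply: inL2Z; exact: inL2D.
rewrite (_ : (fun p => _) = (fun p => - 2^-1 * (w p - w (- p)))); last first.
  by apply/funext => p; rewrite mulNr mulrC.
by apply: inL2Z; exact: inL2B.
Qed.

Lemma fourier_on_hartley n f : inL2 f ->
  fourier_on `[- n%:R, n%:R] f = fourier_of (hartley (trunc n f)).
Proof.
move=> f2; apply/funext => p; have ti := integrable_trunc n f2.
have mc (k : R) : measurable_fun setT (fun x : R => cos (k * x)).
  by apply: continuous_measurable_fun; exact: cos_mul_continuous.
have ms (k : R) : measurable_fun setT (fun x : R => sin (k * x)).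
  by apply: continuous_measurable_fun; exact: sin_mul_continuous.
pose fC (x : R) : R := trunc n f x * cos (p * x).
pose fS (x : R) : R := trunc n f x * sin (p * x).
have ic : integrable fC.
  by apply: (integrable_mul_bounded ti (mc p) (B := 1)) => x; exact: cos_max.
have is_ : integrable fS.
  by apply: (integrable_mul_bounded ti (ms p) (B := 1)) => x; exact: sin_max.
pose C := \int[mu]_x fC x.
pose S := \int[mu]_x fS x.
have hp : hartley (trunc n f) p = normalization * (C + S).
  rewrite /C /S -RintegralD// -RintegralZl//; last first.
    rewrite (_ : _ \o _ = ((EFin \o fC) \+
      (EFin \o fS))%E)//; exact: integrableD.
  by apply: eq_Rintegral => x _; rewrite /fC /fS /hker/= /cas; ring.
have hN : hartley (trunc n f) (- p) = normalization * (C - S).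
  rewrite /C /S -RintegralB// -RintegralZl//; last first.
    rewrite (_ : _ \o _ = ((EFin \o fC) \-
      (EFin \o fS))%E)//; exact: integrableB.
  by apply: eq_Rintegral => x _; rewrite /fC /fS /hker/= /cas mulNr cosN sinN; ring.
have -> : fourier_of (hartley (trunc n f)) p = (normalization * C) -i* (normalization * S).
  by rewrite /fourier_of /even_part /odd_part hp hN; congr (_ -i* _); field.
rewrite /fourier_on /cintegral -/normalization.
rewrite (_ : \int[mu]_(x in _) complex.Re _ = C); last first.
  rewrite Rintegral_mkcond; apply: eq_Rintegral => x _.
  rewrite patchE /fC /fS /trunc /box indicE /expi cosN.
  by case: (x \in _) => /=; [ring|rewrite mulr0 mul0r].
rewrite (_ : \int[mu]_(x in _) complex.Im _ = - S).
  by simpc.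
rewrite /S -[RHS]mulN1r -RintegralZl// Rintegral_mkcond; apply: eq_Rintegral => x _.
rewrite patchE /fC /fS /trunc /box indicE /expi sinN.
by case: (x \in _) => /=; [ring|rewrite mulr0 mul0r mulr0].
Qed.

Notation cnorm F := ('N[mu]_2%:R%:E[EFin \o (fun p => normc (F p))])%E.

Lemma cnorm_fourier_of w : inL2 w -> cnorm (fourier_of w) = (normL2 w)%:E.
Proof.
move=> w2; rewrite LnormE energy_fourier_of; last exact: inL2_measurable.
by rewrite -LnormE LnormE_fin.
Qed.

Lemma is_fourier_of_hartley f w : is_hartley f w -> is_fourier f (fourier_of w).
Proof.
move=> [f2 w2 fw]; have [r2 i2] := fourier_of_inL2 w2; split => //.
rewrite (_ : (fun n => _) = (fun n => (normL2 (fun p => hartley (trunc n f) p - w p))%:E)).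
  by apply: cvg_EFin => //; exact: nearW.
apply/funext => n; rewrite fourier_on_hartley//.
have d2 : inL2 (fun p => w p - hartley (trunc n f) p).
  by apply: inL2B => //; exact: inL2_hartley_trunc.
rewrite normL2BC -cnorm_fourier_of//; apply: eq_Lnorm => p.
by congr EFin; rewrite -fourier_ofB.
Qed.

(** Two limits in L2 of the same sequence; the triangle inequality is used on
   moduli. *)
Lemma is_fourier_unique f F G : is_fourier f F -> is_fourier f G -> F = G %[ae mu].
Proof.
move=> [f2 Fr Fi FF] [_ Gr Gi GG].
have mF : measurable_complex F by split; exact: inL2_measurable.
have mG : measurable_complex G by split; exact: inL2_measurable.
have mh n : measurable_complex (fourier_on `[- n%:R, n%:R] f).
  by rewrite fourier_on_hartley//; 
  apply: measurable_fourier_of; apply: inL2_measurable; exact: inL2_hartley_trunc.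
pose a n p : R := normc (F p - fourier_on `[- n%:R, n%:R] f p).
pose b n p : R := normc (G p - fourier_on `[- n%:R, n%:R] f p).
pose d p : R := normc (F p - G p).
have ma n : measurable_fun setT (a n) by apply: measurable_normc; exact: measurable_complexB.
have mb n : measurable_fun setT (b n) by apply: measurable_normc; exact: measurable_complexB.
have md : measurable_fun setT d by apply: measurable_normc; exact: measurable_complexB.
have dab n : ('N[mu]_2%:R%:E[EFin \o d] <=
    'N[mu]_2%:R%:E[EFin \o a n] + 'N[mu]_2%:R%:E[EFin \o b n])%E.
  have M : ('N[mu]_2%:R%:E[EFin \o (a n \+ b n)%R] <=
      'N[mu]_2%:R%:E[EFin \o a n] + 'N[mu]_2%:R%:E[EFin \o b n])%E.
    by apply: eminkowski; [exact: ma|exact: mb|rewrite lee_fin ler1n].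
  apply: le_trans M.
  rewrite !LnormE; apply: gt0_ler_poweR.
  - by rewrite invr_ge0.
  - by rewrite in_itv/= leey energy_ge0.
  - by rewrite in_itv/= leey energy_ge0.
  apply: ge0_le_integralT.
  - by move=> x; rewrite lee_fin sqr_ge0.
  - by apply/measurable_EFinP/measurable_funX.
  - by apply/measurable_EFinP/measurable_funX/measurable_funD.
  move=> x; rewrite lee_fin ler_pXn2r ?nnegrE ?addr_ge0 ?normc_ge0//.
  rewrite /d /a /b /=; set h := fourier_on _ _ _.
  rewrite (_ : F x - G x = (F x - h) + - (G x - h)); last by rewrite opprB addrA subrK.
  by apply: le_trans (@le_normcD R (F x - h) (- (G x - h))) _; rewrite (@normcN R (G x - h)).
have d0 : ('N[mu]_2%:R%:E[EFin \o d] <= 0)%E.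
  have : ('N[mu]_2%:R%:E[EFin \o a n] + 'N[mu]_2%:R%:E[EFin \o b n] @[n --> \oo] --> 0 + 0)%E.
    exact: cvgeD.
  rewrite adde0 => ab0; rewrite -(cvg_lim _ ab0)//.
  by apply: lime_ge; [exact: (cvgP _ ab0)|exact: nearW].
have d00 : 'N[mu]_2%:R%:E[EFin \o d]%E = 0%E by apply/le_anti; rewrite d0 Lnorm_ge0.
have d2 : inL2 d.
  by apply/andP; rewrite !inE/=; split => //; rewrite /finite_norm d00.
have := normL2_eq0 d2; rewrite /normL2 d00 => /(_ erefl).
apply: filterS => p /(_ I) dp _.
by apply/eqP; rewrite -subr_eq0; apply/eqP; exact: Normc.eq0_normc.
Qed.


End fourier_of_hartley.

(** * The linear equation *)

Section linear_equation.
Local Open Scope complex_scope.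
Context {R : realType}.
Notation mu := (leb R).
Notation normc := Normc.normc.
Variables a b C : R.
Hypothesis C0 : 0 < C.
Hypothesis hsymbol : forall p : R, p != 0 -> C <= normc (symbol a b p).
Implicit Types (h u w : R -> R).

Lemma ae_neq0 : {ae mu, forall p : R, p != 0}.
Proof.
exists [set 0]; split => //; first exact: lebesgue_measure_set1.
by move=> p /= /negP; rewrite negbK => /eqP.
Qed.

(** Every function in L2 has a Hartley transform, and Fourier transforms are
   unique, so that solutions can be described by Hartley transforms alone. *)
Lemma is_solution_hartley h u : is_solution a b h u ->
  exists wu wh, [/\ is_hartley u wu, is_hartley h wh &
    {ae mu, forall p, symbol a b p * fourier_of wu p = fourier_of wh p}].
Proof.
move=> [U [H [uU hH UH]]].
have [u2 _ _ _] := uU; have [h2 _ _ _] := hH.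
have [wu uwu] := is_hartley_ex u2; have [wh hwh] := is_hartley_ex h2.
exists wu, wh; split => //.
have UE := is_fourier_unique uU (is_fourier_of_hartley uwu).
have HE := is_fourier_unique hH (is_fourier_of_hartley hwh).
by apply: filterS3 UE HE UH => p /(_ I) -> /(_ I) ->.
Qed.

Lemma hartley_is_solution h u wu wh : is_hartley u wu -> is_hartley h wh ->
  {ae mu, forall p, symbol a b p * fourier_of wu p = fourier_of wh p} ->
  is_solution a b h u.
Proof.
move=> uwu hwh E; exists (fourier_of wu), (fourier_of wh); split => //.
  exact: is_fourier_of_hartley.
exact: is_fourier_of_hartley.
Qed.

Lemma is_solutionB h u h' u' : is_solution a b h u -> is_solution a b h' u' ->
  is_solution a b (fun x => h x - h' x) (fun x => u x - u' x).
Proof.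
move=> /is_solution_hartley[wu [wh [uw hw E]]] /is_solution_hartley[wu' [wh' [uw' hw' E']]].
apply: (hartley_is_solution (is_hartleyB uw uw') (is_hartleyB hw hw')).
by apply: filterS2 E E' => p E E'; rewrite -!fourier_ofB mulrBr E E'.
Qed.

Lemma is_solution_ae h u h' u' : is_solution a b h u ->
  h = h' %[ae mu] -> u = u' %[ae mu] -> measurable_fun setT h' ->
  measurable_fun setT u' -> is_solution a b h' u'.
Proof.
move=> /is_solution_hartley[wu [wh [uw hw E]]] hh uu mh mu'.
have [_ /inL2_measurable mwu _] := uw; have [_ /inL2_measurable mwh _] := hw.
apply: hartley_is_solution E.
  by apply: (is_hartley_ae uw) => //; exact: aeW.
by apply: (is_hartley_ae hw) => //; exact: aeW.
Qed.

(** The isometry reduces this to C |Fu| <= |Fh| almost everywhere for the Fourier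
   transforms Fu and Fh, which is the lower bound on the symbol. *)
Lemma is_solution_bound h u : is_solution a b h u -> C * normL2 u <= normL2 h.
Proof.
move=> /is_solution_hartley[wu [wh [uw hw E]]].
rewrite -(is_hartley_isometry uw) -(is_hartley_isometry hw).
have [_ wu2 _] := uw; have [_ wh2 _] := hw.
have mwu := inL2_measurable wu2; have mwh := inL2_measurable wh2.
rewrite -(@ler_pXn2r _ 2)// ?nnegrE ?mulr_ge0 ?normL2_ge0 ?(ltW C0)//.
rewrite -lee_fin exprMn EFinM !normL2_sqr//.
rewrite -(energy_fourier_of mwu) -(energy_fourier_of mwh).
have mnu := measurable_normc (measurable_fourier_of mwu).
have mnh := measurable_normc (measurable_fourier_of mwh).
rewrite /energy -ge0_integralZl//; last 3 first.
- by apply/measurable_EFinP/measurable_funX.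
- by move=> x _; rewrite lee_fin sqr_ge0.
- by rewrite lee_fin sqr_ge0.
apply: ae_ge0_le_integral => //.
- by move=> x _; rewrite -EFinM lee_fin mulr_ge0 ?sqr_ge0.
- by apply: emeasurable_funM => //; apply/measurable_EFinP/measurable_funX.
- by move=> x _; rewrite lee_fin sqr_ge0.
- by apply/measurable_EFinP/measurable_funX.
apply: filterS2 E ae_neq0 => p E p0 _.
rewrite -EFinM lee_fin -exprMn ler_pXn2r ?nnegrE ?mulr_ge0 ?normc_ge0 ?(ltW C0)//.
by rewrite -E Normc.normcM ler_wpM2r ?normc_ge0// hsymbol.
Qed.

(** Used in contrapositive form, to get |u0| > 0 from f being nonzero: the
   isometry lets both norms be computed on the transforms, where the equation is
   a multiplication by the symbol. *)
Lemma is_solution_eq0 h u : is_solution a b h u -> normL2 u = 0 -> normL2 h = 0.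
Proof.
move=> /is_solution_hartley[wu [wh [uw hw E]]] u0.
rewrite -(is_hartley_isometry hw).
have [_ wu2 _] := uw; have [_ wh2 _] := hw.
have mwu := inL2_measurable wu2; have mwh := inL2_measurable wh2.
have mnu := measurable_normc (measurable_fourier_of mwu).
have mnh := measurable_normc (measurable_fourier_of mwh).
have wu0 : energy (fun p => normc (fourier_of wu p)) = 0%E.
  by rewrite energy_fourier_of// -normL2_sqr// (is_hartley_isometry uw) u0 expr0n.
have Fu2 : inL2 (fun p => normc (fourier_of wu p)).
  by apply/inL2P; rewrite wu0.
have Fu0 : normL2 (fun p => normc (fourier_of wu p)) = 0.
  by apply/eqP; rewrite -sqrf_eq0 -eqe normL2_sqr// wu0.
apply/eqP; rewrite -sqrf_eq0 -eqe normL2_sqr// -energy_fourier_of//.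
rewrite (@energy_eq _ _ (fun=> 0)) ?/energy.
- by rewrite integral0_eq// => x _; rewrite expr0n.
- apply: filterS2 (normL2_eq0 Fu2 Fu0) E => p /(_ I) Fp Ep _.
  by rewrite -Ep Normc.normcM Fp mulr0.
- exact: mnh.
- exact: measurable_cst.
Qed.

(** Division by the symbol l - i b p maps transforms of real functions to
   transforms of real functions, because l is even.  In terms of Hartley
   transforms the equation reads l(p) w(p) + b p w(-p) = wh(p); this and the same
   equation at -p form a linear system with determinant l^2 + (b p)^2, which is
   the square of the modulus of the symbol. *)
Lemma is_solution_ex h : inL2 h -> exists2 u, inL2 u & is_solution a b h u.
Proof.
move=> h2; have [wh hw] := is_hartley_ex h2; have [_ wh2 _] := hw.
have mwh := inL2_measurable wh2; have whN2 := inL2_opp wh2.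
pose l (p : R) : R := ln (`|p| / expR a).
pose D (p : R) : R := l p ^+ 2 + (b * p) ^+ 2.
pose w (p : R) : R := (l p * wh p - b * p * wh (- p)) / D p.
have lN p : l (- p) = l p by rewrite /l normrN.
have DN p : D (- p) = D p by rewrite /D lN mulrN sqrrN.
have DC p : p != 0 -> C ^+ 2 <= D p.
  move=> /hsymbol; rewrite -(@ler_pXn2r _ 2)// ?nnegrE ?(ltW C0) ?normc_ge0//.
  by rewrite normc_sqr sqrrN.
have D0 p : p != 0 -> D p != 0.
  by move=> /DC DCp; rewrite gt_eqF// (lt_le_trans _ DCp)// exprn_gt0.
have mbp : measurable_fun setT (fun p : R => b * p) by exact: measurable_funM.
have ml : measurable_fun setT l.
  apply: (measurableT_comp (@measurable_ln R)).
  by apply: measurable_funM => //; exact: measurableT_comp.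
have mw : measurable_fun setT w.
  apply: measurable_funM.
    apply: measurable_funB; first exact: measurable_funM.
    by apply: measurable_funM => //; exact: measurable_opp_arg.
  rewrite (_ : (fun p => (D p)^-1) = (fun p => D p `^ (-1))); last first.
    by apply/funext => p; rewrite powR_inv1// addr_ge0// sqr_ge0.
  apply: (measurableT_comp (measurable_powR _)).
  by apply: measurable_funD; exact: measurable_funX.
have w2 : inL2 w.
  have s2 : inL2 (fun p => `|wh p| + `|wh (- p)|).
    by apply: inL2D; exact: inL2_norm.
  apply: (inL2_dominated (B := C^-1) _ mw s2 _).1.
    by rewrite invr_ge0 ltW.
  move=> p; have [->|p0] := eqVneq p 0.
    (* ln 0 = 0, so that w vanishes at 0 *)
    rewrite /w mulr0 mul0r subr0 /D /l normr0 mul0r ln0// mul0r mul0r normr0.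
    by rewrite mulr_ge0// invr_ge0 ltW.
  have DCp := DC p p0; have Dp : 0 < D p by rewrite (lt_le_trans _ DCp)// exprn_gt0.
  pose s := Num.sqrt (D p).
  have s0 : 0 < s by rewrite sqrtr_gt0.
  have ss : s * s = D p by rewrite -expr2 sqr_sqrtr// ltW.
  have Cs : C <= s.
    have : C ^+ 2 <= s ^+ 2 by rewrite sqr_sqrtr// ltW.
    by rewrite ler_pXn2r// nnegrE ltW.
  have ls : `|l p| <= s.
    by rewrite -sqrtr_sqr ler_wsqrtr// /D lerDl sqr_ge0.
  have bs : `|b * p| <= s.
    by rewrite -sqrtr_sqr ler_wsqrtr// /D lerDr sqr_ge0.
  rewrite /w normrM normfV (gtr0_norm Dp) ler_pdivrMr//.
  apply: le_trans (ler_normB _ _) _.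
  apply: (@le_trans _ _ (s * (`|wh p| + `|wh (- p)|))).
    by rewrite [`|l p * _|]normrM [`|b * p * _|]normrM mulrDr lerD// ler_wpM2r.
  have T0 : 0 <= `|wh p| + `|wh (- p)| by rewrite addr_ge0.
  rewrite (ger0_norm T0) [leRHS]mulrAC ler_wpM2r//.
  by rewrite ler_pdivlMl// mulrC -ss ler_wpM2l// ltW.
have [u wu] := is_hartley_ex w2; have uw := is_hartley_sym wu.
have [u2 _ _] := uw; exists u => //.
apply: (hartley_is_solution uw hw).
apply: filterS ae_neq0 => p p0; have Dp := D0 p p0.
have l1 : l p * w p + b * p * w (- p) = wh p.
  rewrite /w lN DN opprK; move: Dp; rewrite /D.
  by move: (l p) (wh p) (wh (- p)) => x y z Dp; field.
have l2 : l p * w (- p) - b * p * w p = wh (- p).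
  rewrite /w lN DN opprK; move: Dp; rewrite /D.
  by move: (l p) (wh p) (wh (- p)) => x y z Dp; field.
rewrite /fourier_of /symbol -/(l p) /even_part /odd_part -l1 -l2; simpc.
by congr (_ +i* _); field.
Qed.

End linear_equation.

(** * The nonlinear right-hand side *)

Section nonlinearity.
Context {R : realType}.
Notation mu := (leb R).
Notation integrable f := (mu.-integrable setT (EFin \o f)).

(** The difference g s - g t is an integral of derive1 g over an interval of
   length |s - t|. *)
Lemma recovered_lipschitz (g : R -> R) (M : R) : 0 < M ->
  recovered_from_derivative g -> derive1 g \in Lfun mu +oo%E ->
  ('N[mu]_+oo[EFin \o derive1 g] <= M%:E)%E ->
  forall s t, `|g s - g t| <= M * `|s - t|.
Proof.
move=> M0 [_ _ gE] /andP[/[!inE]/= mg' _] gM.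
have g'M : {ae mu, forall z, `|derive1 g z| <= M}.
  move: gM; rewrite unlock; case: ifPn => [_ /ess_supP|].
    by apply: filterS => z; rewrite /= lee_fin.
  (* the norm is 0 by convention on a null space, but the line is not null *)
  move=> muT _; exfalso; move: muT; rewrite -leNgt => muT.
  have : (mu `[0%R, 1%R] <= mu setT)%E by apply: le_measure; rewrite ?inE.
  rewrite (lebesgue_measure_itv `[0%R, 1%R])/= lte_fin ltr01 => /le_trans/(_ muT).
  by rewrite oppr0 adde0 lee_fin ler10.
have le_s s t : t <= s -> `|g s - g t| <= M * (s - t).
  move=> ts; rewrite gE//.
  have mg := measurable_funTS (D := `[t, s]) mg'.
  have mEg : measurable_fun `[t, s] (EFin \o derive1 g) by exact/measurable_EFinP.
  rewrite -lee_fin.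
  apply: (@le_trans _ _ `|(\int[mu]_(z in `[t, s]) (derive1 g z)%:E)|%E).
    by rewrite /Rintegral; case: (\int[mu]_(z in _) _)%E => [r||] //=; rewrite normr0 leey.
  apply: le_trans (le_abse_integral mu _ mEg) _ => //.
  apply: (@le_trans _ _ (\int[mu]_(z in `[t, s]) (cst M%:E z))%E).
    apply: ae_ge0_le_integral => //.
    - exact: measurableT_comp.
    - by move=> z _; rewrite lee_fin ltW.
    by apply: filterS g'M => z gz _; rewrite /= lee_fin.
  rewrite integral_cst//= (lebesgue_measure_itv `[t, s])/= lte_fin.
  case: ltP => [_|st]; first by rewrite -EFinB -EFinM.
  by rewrite mule0 lee_fin mulr_ge0 ?(ltW M0)// subr_ge0.
move=> s t; have [ts|/ltW ts] := leP t s.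
  by rewrite (ger0_norm (_ : 0 <= s - t)) ?subr_ge0// le_s.
by rewrite distrC [`|s - t|]distrC (ger0_norm (_ : 0 <= t - s)) ?subr_ge0// le_s.
Qed.

Variables (eps M : R) (K g u0 : R -> R).
Hypotheses (eps0 : 0 < eps) (M0 : 0 < M).
Hypothesis K1 : K \in Lfun mu 1.
Hypothesis g0 : g 0 = 0.
Hypothesis glip : forall s t, `|g s - g t| <= M * `|s - t|.
Hypothesis u02 : inL2 u0.

Lemma lipschitz_measurable : measurable_fun setT g.
Proof.
apply: continuous_measurable_fun => x; apply/cvgrPdist_le => e e0.
near=> y; apply: le_trans (glip _ _) _; rewrite -ler_pdivlMl// mulrC.
near: y; apply: cvgr_dist_le; last by rewrite divr_gt0.
exact: cvg_id.
Unshelve. all: by end_near. Qed.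

Let measurable_K : measurable_fun setT K.
Proof. by have /Lfun1_integrable/integrable_measurable := K1. Qed.

Let K_lty : (\int[mu]_x `|K x|%:E < +oo)%E.
Proof. by have /Lfun1_integrable/integrableP[] := K1. Qed.

Lemma normL1E : normL1 K = \int[mu]_x `|K x|.
Proof. by rewrite /normL1 Lnorm1. Qed.

Lemma inL2_superposition v1 v2 : inL2 v1 -> inL2 v2 ->
  inL2 (fun y => g (v1 y) - g (v2 y)) /\
  normL2 (fun y => g (v1 y) - g (v2 y)) <= M * normL2 (fun y => v1 y - v2 y).
Proof.
move=> v12 v22; apply: inL2_dominated => //; first exact: ltW.
  have mg := lipschitz_measurable.
  by apply: measurable_funB; apply: (measurableT_comp mg); exact: inL2_measurable.
exact: inL2B.
Qed.

(** As g 0 = 0, the Lipschitz bound also controls the size of g. *)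
Lemma inL2_g_shift v : inL2 v -> inL2 (fun y => g (u0 y + v y)) /\
  normL2 (fun y => g (u0 y + v y)) <= M * normL2 (fun y => u0 y + v y).
Proof.
move=> v2; have := inL2_superposition (inL2D u02 v2) (@inL2_0 R).
rewrite (_ : (fun y => g (u0 y + v y) - g 0) = (fun y => g (u0 y + v y))); last first.
  by apply/funext => y; rewrite g0 subr0.
rewrite (_ : (fun y => u0 y + v y - 0) = (fun y => u0 y + v y))//.
by apply/funext => y; rewrite subr0.
Qed.

Lemma nonlinear_rhs_inL2 v : inL2 v -> inL2 (nonlinear_rhs eps K g u0 v) /\
  normL2 (nonlinear_rhs eps K g u0 v) <=
    eps * (normL1 K * (M * normL2 (fun y => u0 y + v y))).
Proof.
move=> v2; have [G2 Gn] := inL2_g_shift v2.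
have [c2 cn _] := young measurable_K K_lty G2.
rewrite /nonlinear_rhs; split; first exact: inL2Z.
rewrite normL2Z// gtr0_norm// ler_pM2l//; apply: le_trans cn _.
by rewrite normL1E ler_wpM2l//; exact: Rintegral_ge0.
Qed.

(** The difference of two convolutions is the convolution of the difference only
   where both integrals converge, that is almost everywhere. *)
Lemma nonlinear_rhs_lipschitz v1 v2 : inL2 v1 -> inL2 v2 ->
  normL2 (fun x => nonlinear_rhs eps K g u0 v1 x - nonlinear_rhs eps K g u0 v2 x) <=
    eps * (normL1 K * (M * normL2 (fun y => v1 y - v2 y))).
Proof.
move=> v12 v22.
have [G1 _] := inL2_g_shift v12; have [G2 _] := inL2_g_shift v22.
have [D2 Dn] := inL2_superposition (inL2D u02 v12) (inL2D u02 v22).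
have [c12 _ i1] := young measurable_K K_lty G1.
have [c22 _ i2] := young measurable_K K_lty G2.
have [d2 dn _] := young measurable_K K_lty D2.
rewrite (_ : normL2 (fun y => v1 y - v2 y) =
    normL2 (fun y => (u0 y + v1 y) - (u0 y + v2 y))); last first.
  by apply: eq_normL2 => y; ring.
apply: (@le_trans _ _ (eps * normL2 (fun x => \int[mu]_y
    (K (x - y) * (g (u0 y + v1 y) - g (u0 y + v2 y)))))).
  rewrite -[X in X * _]gtr0_norm// -normL2Z// le_eqVlt; apply/orP; left; apply/eqP.
  apply: normL2_ae.
  - apply: filterS2 i1 i2 => x i1 i2 _; rewrite /nonlinear_rhs -mulrBr; congr (_ * _).
    by rewrite -RintegralB//; apply: eq_Rintegral => y _; rewrite mulrBr.
  - by apply: inL2_measurable; apply: inL2B; exact: inL2Z.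
  - by apply: inL2_measurable; exact: inL2Z.
rewrite ler_pM2l//; apply: le_trans dn _.
by rewrite normL1E ler_wpM2l//; exact: Rintegral_ge0.
Qed.

End nonlinearity.

(** * Fixed points in a ball of L2 *)

Section L2_classes.
Context {R : realType}.
Notation mu := (leb R).
Implicit Types u v w : L2 R.

Lemma inL2_class u : inL2 (u : R -> R).
Proof.
apply/andP; rewrite !inE/=; split; last exact: Lebesgue_finite.
have mr := measurable_funPT (repr (LebesgueSpace.sort u)).
by move=> mD Y mY; exact: mr mD Y mY.
Qed.

Lemma L2_eq u v : (u : R -> R) = (v : R -> R) %[ae mu] -> u = v.
Proof.
case: u => u [[mu_]]; case: v => v [[mv]] /= uv.
have E : u = v.
  rewrite -[u]reprK -[v]reprK; apply/eqmodP/asboolP; exact: uv.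
by case: _ / E mv {uv} => mv; rewrite (Prop_irrelevance mu_ mv).
Qed.

Lemma L2_class_of (f : R -> R) : inL2 f -> exists u, (u : R -> R) = f %[ae mu].
Proof.
move=> f2; have mf := inL2_measurable f2.
have mfR : @measurable_fun _ _ (measurableTypeR R) (measurableTypeR R) setT f.
  by move=> mD Y mY; exact: mf mD Y mY.
pose mf_ := isMeasurableFun.Build _ _ (measurableTypeR R) (measurableTypeR R) f mfR.
pose F : {mfun measurableTypeR R >-> measurableTypeR R} := HB.pack f mf_.
pose c : {mfun_ mu, measurableTypeR R >-> measurableTypeR R} :=
  \pi_({mfun_ mu, measurableTypeR R >-> measurableTypeR R})%qT F.
have cf : (c : R -> R) = f %[ae mu].
  by have /eqmodP/asboolP := reprK c.
have cfin : finite_norm mu 2%:R%:E (c : R -> R).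
  have mc : measurable_fun setT (c : R -> R).
    have mr := measurable_funPT (repr c).
    by move=> mD Y mY; exact: mr mD Y mY.
  have c2 : inL2 (c : R -> R) by apply: inL2_ae f2 => //; exact: ae_eq_sym.
  by move: c2 => /andP[_]; rewrite inE.
pose c_ := isFinLebesgue.Build _ _ R mu _ (lee1n 2) c cfin.
pose u : L2 R := HB.pack c c_.
by exists u.
Qed.

Lemma distL2_eq0 u v : distL2 u v <= 0 -> u = v.
Proof.
move=> uv; have u2 := inL2_class u; have v2 := inL2_class v.
have /(normL2_eq0 (inL2B u2 v2)) : normL2 (fun x => u x - v x) = 0.
  by apply/le_anti; rewrite normL2_ge0 andbT.
move=> E; apply: L2_eq; apply: filterS E => x /= /[apply] /eqP.
by rewrite subr_eq0 => /eqP.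
Qed.

Lemma le0_geometric (x D q : R) : 0 <= q -> q < 1 -> (forall n, x <= D * q ^+ n) -> x <= 0.
Proof.
move=> q0 q1 xD.
have c0 : (fun n => D * q ^+ n) @ \oo --> 0 by apply: cvg_geometric; rewrite ger0_norm.
rewrite -(cvg_lim _ c0)//; apply: limr_ge; first exact: (cvgP _ c0).
exact: nearW.
Qed.

(** Banach's fixed point theorem: Picard iterates converge geometrically, and the
   ball is closed.  The iteration runs on classes and its limit is taken on
   representatives. *)
Lemma ballL2_fixed_point (rho q : R) (t : L2 R -> L2 R) : 0 <= rho ->
  0 <= q -> q < 1 ->
  (forall v, ballL2 rho v -> ballL2 rho (t v)) ->
  (forall v w, ballL2 rho v -> ballL2 rho w -> distL2 (t v) (t w) <= q * distL2 v w) ->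
  exists2 u, ballL2 rho u & t u = u.
Proof.
move=> rho0 q0 q1 tB tq.
have [z zE] := L2_class_of (@inL2_0 R).
have mz := inL2_measurable (inL2_class z).
have zB : ballL2 rho z.
  by rewrite /ballL2/= (normL2_ae zE mz (measurable_cst _)) normL2_0.
pose s n := iter n t z.
have sB n : ballL2 rho (s n) by elim: n => [//|n IH]; exact: tB.
pose D := distL2 (t z) z.
have D0 : 0 <= D by exact: normL2_ge0.
have sD n : distL2 (s n.+1) (s n) <= D * q ^+ n.
  elim: n => [|n IH]; first by rewrite expr0 mulr1.
  apply: le_trans (tq _ _ (sB n.+1) (sB n)) _.
  by rewrite exprS mulrCA ler_wpM2l.
have s2 n := inL2_class (s n).
have [f f2 sf] := riesz_fischer_geometric D0 q0 q1 s2 sD.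
have [u uf] := L2_class_of f2; have u2 := inL2_class u.
have mf := inL2_measurable f2; have mu_ := inL2_measurable u2.
have {}sf n : distL2 (s n) u <= D / (1 - q) * q ^+ n.
  rewrite mulrAC; apply: le_trans (sf n); rewrite le_eqVlt; apply/orP; left; apply/eqP.
  apply: normL2_ae.
  - by apply: filterS uf => x /= /[apply] ->.
  - by apply: inL2_measurable; exact: inL2B.
  - by apply: inL2_measurable; exact: inL2B.
have uB : ballL2 rho u.
  rewrite /ballL2/= -subr_le0; apply: (le0_geometric q0 q1) => n.
  rewrite lerBlDl; apply: le_trans (normL2_le_add u2 (s2 n)) _.
  by rewrite normL2BC; apply: lerD; [exact: sB|exact: sf].
exists u => //; apply: distL2_eq0; apply: (le0_geometric q0 q1 (D := 2 * (D / (1 - q)))) => n.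
have tu2 := inL2_class (t u).
apply: le_trans (normL2_trianglel tu2 (s2 n.+1) u2) _.
rewrite (_ : 2 * (D / (1 - q)) * q ^+ n =
  D / (1 - q) * q ^+ n + D / (1 - q) * q ^+ n); last by ring.
apply: lerD; last first.
  apply: le_trans (sf n.+1) _; rewrite exprS ler_wpM2l ?divr_ge0 ?subr_ge0 ?(ltW q1)//.
  by rewrite ler_piMl ?exprn_ge0// ltW.
apply: le_trans (tq _ _ uB (sB n)) _; rewrite [distL2 _ _]normL2BC.
apply: le_trans (sf n); rewrite ler_piMl ?normL2_ge0// ltW//.
Qed.

End L2_classes.

(** * Solvability of the nonlinear equation *)
Theorem theorem3 (R : realType) (a b C M rho eps : R) (f K g u0 : R -> R)
  (hb : b != 0)
  (hC : 0 < C)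
  (hsymbol : forall p : R, p != 0 -> C <= Normc.normc (symbol a b p))
  (hf : f \in Lfun (leb R) 2%:R%:E)
  (hf0 : ~ (f = cst 0 %[ae leb R]))
  (hK : K \in Lfun (leb R) 1)
  (hK0 : ~ (K = cst 0 %[ae leb R]))
  (hM : 0 < M)
  (hg_neq0 : exists s, g s != 0)
  (hg0 : g 0 = 0)
  (hg : recovered_from_derivative g)
  (hg' : derive1 g \in Lfun (leb R) +oo%E)
  (hg'M : ('N[leb R]_+oo[EFin \o derive1 g] <= M%:E)%E)
  (hrho0 : 0 < rho)
  (hrho1 : rho <= 1)
  (hu0 : u0 \in Lfun (leb R) 2%:R%:E)
  (hu0f : is_solution a b f u0)
  (heps0 : 0 < eps)
  (heps : eps <= rho * C / (M * normL1 K * (normL2 u0 + 1))) :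
  exists t : {fun ballL2 rho >-> ballL2 rho},
    [/\ (* t v is the unique solution in the ball *)
        forall v : L2 R, ballL2 rho v ->
          is_solution a b (nonlinear_rhs eps K g u0 v) (t v) /\
          (forall u : L2 R, ballL2 rho u ->
             is_solution a b (nonlinear_rhs eps K g u0 v) u -> u = t v),
        (* t is a strict contraction *)
        exists q : R, [/\ 0 <= q, q < 1 &
          forall v1 v2 : L2 R, ballL2 rho v1 -> ballL2 rho v2 ->
            distL2 (t v1) (t v2) <= q * distL2 v1 v2] &
        (* the unique fixed point is the only solution in the ball *)
        exists up : L2 R,
          [/\ ballL2 rho up /\ t up = up,
              forall w : L2 R, ballL2 rho w -> t w = w -> w = up,
              is_solution a b (nonlinear_rhs eps K g u0 up) up &
              forall w : L2 R, ballL2 rho w ->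
                is_solution a b (nonlinear_rhs eps K g u0 w) w -> w = up]].
Proof.
have glip := recovered_lipschitz hM hg hg' hg'M.
have rhs2 (v : L2 R) := nonlinear_rhs_inL2 heps0 hM hK hg0 glip hu0 (inL2_class v).
have rhsB (v1 v2 : L2 R) := nonlinear_rhs_lipschitz heps0 hM hK hg0 glip hu0
  (inL2_class v1) (inL2_class v2).
have sol_bound := is_solution_bound hC hsymbol.
have nu0 : 0 < normL2 u0.
  rewrite lt_neqAle normL2_ge0 andbT eq_sym; apply/eqP => /(is_solution_eq0 hu0f).
  by move=> /(normL2_eq0 hf).
pose k := normL1 K.
have k0 : 0 < k.
  have : 0 <= k by rewrite /k normL1E; exact: Rintegral_ge0.
  rewrite le_eqVlt => /predU1P[k0|//]; move: heps.
  by rewrite -/k -k0 mulr0 mul0r invr0 mulr0 leNgt heps0.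
have n1 : 0 < normL2 u0 + 1 by rewrite ltr_pwDr// ltW.
have hepsC : eps * (k * (M * (normL2 u0 + 1))) <= rho * C.
  move: heps; rewrite -/k ler_pdivlMr ?mulr_gt0//.
  by rewrite (_ : M * k * (normL2 u0 + 1) = k * (M * (normL2 u0 + 1)))//; ring.
pose q := eps * (k * M) / C.
have q0 : 0 <= q by rewrite divr_ge0 ?mulr_ge0// ltW.
have q1 : q < 1.
  rewrite ltr_pdivrMr// mul1r -(ltr_pM2r n1).
  apply: (@le_lt_trans _ _ (rho * C)).
    by rewrite (_ : _ * (_ + 1) = eps * (k * (M * (normL2 u0 + 1))))//; ring.
  apply: (@le_lt_trans _ _ (1 * C)); first by rewrite ler_wpM2r// ltW.
  by rewrite mul1r ltr_pMr// ltrDr.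
have /choice[t tP] (v : L2 R) : exists u : L2 R, is_solution a b (nonlinear_rhs eps K g u0 v) u.
  have [u u2 uS] := is_solution_ex hC hsymbol (rhs2 v).1.
  have [c cu] := L2_class_of u2; exists c.
  apply: (is_solution_ae uS).
  - exact: aeW.
  - exact: ae_eq_sym.
  - by apply: inL2_measurable; exact: (rhs2 v).1.
  - by apply: inL2_measurable; exact: inL2_class.
have t_uniq (v u : L2 R) : is_solution a b (nonlinear_rhs eps K g u0 v) u -> u = t v.
  move=> uS; apply: distL2_eq0; rewrite -(pmulr_rle0 _ hC).
  apply: le_trans (sol_bound _ _ (is_solutionB uS (tP v))) _.
  rewrite (_ : (fun x => _) = (fun=> 0)) ?normL2_0//.
  by apply/funext => x; rewrite subrr.
have tB (v : L2 R) : ballL2 rho v -> ballL2 rho (t v).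
  move=> vB; rewrite /ballL2/= -(ler_pM2l hC).
  apply: le_trans (sol_bound _ _ (tP v)) _; apply: le_trans (rhs2 v).2 _.
  rewrite [C * rho]mulrC; apply: le_trans hepsC.
  rewrite ler_pM2l// ler_pM2l// ler_pM2l//.
  apply: le_trans (normL2D hu0 (inL2_class v)) _.
  by rewrite lerD2l; apply: le_trans hrho1.
have tq (v1 v2 : L2 R) : distL2 (t v1) (t v2) <= q * distL2 v1 v2.
  rewrite -(ler_pM2l hC).
  apply: le_trans (sol_bound _ _ (is_solutionB (tP v1) (tP v2))) _.
  apply: le_trans (rhsB v1 v2) _; rewrite le_eqVlt; apply/orP; left; apply/eqP.
  by rewrite /q /distL2 -/k; field; rewrite gt_eqF.
have [up upB upE] := ballL2_fixed_point (ltW hrho0) q0 q1 tB (fun v w _ _ => tq v w).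
have fix_uniq (w : L2 R) : t w = w -> w = up.
  move=> wE; apply: distL2_eq0; have := tq w up; rewrite wE upE.
  by rewrite -subr_ge0 -[X in _ - X]mul1r -mulrBl nmulr_rge0// subr_lt0.
exists (mkfun_fun tB); split => /=.
- by move=> v vB; split => [|u uB]; [exact: tP|exact: t_uniq].
- by exists q; split.
exists up; split => //.
- by move=> w _; exact: fix_uniq.
- by rewrite -{2}upE; exact: tP.
- by move=> w wB /t_uniq/esym/fix_uniq.
Qed.
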